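(* Let $V$ be a finite-dimensional complex vector space and $\mathfrak g(V)$ one of $\mathfrak{sl}(V)$, $\mathfrak{sp}(V)$, $\mathfrak{so}(V)$. Let $\phi:\mathfrak{sl}_2\oplus\mathfrak{sl}_2\to\mathfrak g(V)$ be a Lie algebra homomorphism, let $e_1,e_2$ be the images of the standard nilpotent generators $e$ of the first and second factor, and suppose that as a module over $\mathfrak{sl}_2\oplus\mathfrak{sl}_2$, $$V\cong\bigoplus_{i=1}^{p}R(n_i-1)\otimes R(m_i-1),$$ where $R(d)$ denotes the irreducible $\mathfrak{sl}_2$-module of dimension $d+1$. Let $\mathfrak J=\{(n_i,m_i):i=1,\dots,p\}$ (a multiset). Then $(e_1,e_2)$ is a principal nilpotent pair in $\mathfrak g(V)$ if and only if: (i) for $\mathfrak{sl}(V)$: $p=1$; (ii) for $\mathfrak{sp}(V)$: $p=1$ and $n_1,m_1$ have different parity; (iii) for $\mathfrak{so}(V)$: either $p=1$ and $n_1,m_1$ have the same parity, or $p=2$ and $\mathfrak J=\{(n,m),(1,1)\}$ or $\mathfrak J=\{(n,1),(1,m)\}$ with $n,m$ both odd.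
   Context: For a complex semisimple Lie algebra $\mathfrak g$ with adjoint group $G$, a principal nilpotent pair is a pair $(e_1,e_2)\in\mathfrak g\oplus\mathfrak g$ with $[e_1,e_2]=0$, $\dim\mathfrak z(e_1,e_2)=\operatorname{rk}\mathfrak g$ (where $\mathfrak z(e_1,e_2)$ is the simultaneous centralizer in $\mathfrak g$), and such that for every $(t_1,t_2)\in(\mathbb C^* )^2$ there is $g\in G$ with $\operatorname{Ad}g(e_i)=t_ie_i$. *)

(* Defs.v *)
From HB Require Import structures.
From mathcomp Require Import all_boot all_order all_algebra.
From mathcomp Require Import reals.
From mathcomp Require Import complex mxtens.
Set Implicit Arguments. Unset Strict Implicit. Unset Printing Implicit Defensive.
Import Order.TTheory GRing.Theory Num.Theory.
Local Open Scope ring_scope.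

Section Defs.
Variable R : realType.
Local Notation C := (R[i]).

(* basis v_0..v_{n-1}: h v_j = (n-1-2j) v_j, f v_j = v_{j+1}, e v_j = j(n-j) v_{j-1};
   matrices act on column vectors. *)
Definition sl2E (n : nat) : 'M[C]_n :=
  \matrix_(i < n, j < n) (if (j : nat) == i.+1 then ((j * (n - j))%N)%:R else 0).
Definition sl2F (n : nat) : 'M[C]_n :=
  \matrix_(i < n, j < n) (if (i : nat) == j.+1 then 1 else 0).
Definition sl2H (n : nat) : 'M[C]_n :=
  \matrix_(i < n, j < n) (if i == j then (n.-1)%:R - (2 * j)%:R else 0).

Definition lie {N : nat} (X Y : 'M[C]_N) : 'M[C]_N := X *m Y - Y *m X.

Definition sl2_triple {N : nat} (E H F : 'M[C]_N) : Prop :=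
  lie H E = 2%:R *: E /\ lie H F = - (2%:R *: F) /\ lie E F = H.

Definition gl_sl (N : nat) : {vspace 'M[C]_N} :=
  lker (linfun (fun X : 'M[C]_N => (\tr X)%:M : 'M[C]_1)).
(* Lie algebra of a bilinear form B (X^T B + B X = 0): sp(V) for B nondegenerate
   alternating, so(V) for B nondegenerate symmetric *)
Definition gl_form (N : nat) (B : 'M[C]_N) : {vspace 'M[C]_N} :=
  lker (linfun (fun X : 'M[C]_N => X^T *m B + B *m X)).

Definition cent_gl (N : nat) (x : 'M[C]_N) : {vspace 'M[C]_N} :=
  lker (linfun (fun X : 'M[C]_N => lie X x)).

Definition is_rank (N : nat) (g : {vspace 'M[C]_N}) (r : nat) : Prop :=
  (exists2 x, x \in g & \dim (g :&: cent_gl x) = r) /\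
  (forall x, x \in g -> (r <= \dim (g :&: cent_gl x))%N).

(* Principal nilpotent pair in g, where Gad is the group of matrices whose conjugation
   action gives the adjoint group of g. *)
Definition principal_pair (N : nat) (g : {vspace 'M[C]_N}) (Gad : 'M[C]_N -> Prop)
    (e1 e2 : 'M[C]_N) : Prop :=
  [/\ e1 \in g, e2 \in g, lie e1 e2 = 0,
      (exists r, is_rank g r /\ \dim (g :&: cent_gl e1 :&: cent_gl e2) = r) &
      forall t1 t2 : C, t1 != 0 -> t2 != 0 ->
        exists a, [/\ Gad a, a \in unitmx,
          a *m e1 *m invmx a = t1 *: e1 & a *m e2 *m invmx a = t2 *: e2]].

(* adjoint groups, acting by conjugation: SL(V), Sp(V,B), SO(V,B) *)
Definition SLgrp (N : nat) (a : 'M[C]_N) : Prop := \det a = 1.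
Definition Isomgrp (N : nat) (B : 'M[C]_N) (a : 'M[C]_N) : Prop := a^T *m B *m a = B.
Definition SOgrp (N : nat) (B : 'M[C]_N) (a : 'M[C]_N) : Prop :=
  a^T *m B *m a = B /\ \det a = 1.

(* phi : sl2 + sl2 -> g(V), given by the images of the standard bases of both factors *)
Definition sl2sl2_hom (N : nat) (g : {vspace 'M[C]_N}) (E1 H1 F1 E2 H2 F2 : 'M[C]_N) : Prop :=
  [/\ (forall X, X \in [:: E1; H1; F1; E2; H2; F2] -> X \in g),
      sl2_triple E1 H1 F1, sl2_triple E2 H2 F2 &
      forall X Y, X \in [:: E1; H1; F1] -> Y \in [:: E2; H2; F2] -> lie X Y = 0].

(* The model module (+)_{i<p} R(n_i - 1) (x) R(m_i - 1), and the hypothesis that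
   V = C^N is isomorphic to it as sl2+sl2-module: an invertible P with
   phi(X) P = P X_model for all basis elements X. *)
Definition model_dim (p : nat) (n m : 'I_p -> nat) : nat := \sum_(i < p) (n i * m i)%N.

Definition model1 (p : nat) (n m : 'I_p -> nat) (A : forall k : nat, 'M[C]_k)
  : 'M[C]_(model_dim n m) :=
  \mxdiag_(i < p) (A (n i) *t (1%:M : 'M[C]_(m i))).
Definition model2 (p : nat) (n m : 'I_p -> nat) (A : forall k : nat, 'M[C]_k)
  : 'M[C]_(model_dim n m) :=
  \mxdiag_(i < p) ((1%:M : 'M[C]_(n i)) *t A (m i)).

Definition module_iso (N p : nat) (n m : 'I_p -> nat) (E1 H1 F1 E2 H2 F2 : 'M[C]_N) : Prop :=
  exists P : 'M[C]_(N, model_dim n m),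
    [/\ row_free P && row_full P,
        [/\ E1 *m P = P *m model1 n m sl2E, H1 *m P = P *m model1 n m sl2H &
            F1 *m P = P *m model1 n m sl2F] &
        [/\ E2 *m P = P *m model2 n m sl2E, H2 *m P = P *m model2 n m sl2H &
            F2 *m P = P *m model2 n m sl2F]].

Definition Jset (p : nat) (n m : 'I_p -> nat) : seq (nat * nat) :=
  [seq (n i, m i) | i <- enum 'I_p].

End Defs.

(* Main.v *)
Require Import Defs.
From HB Require Import structures.
From mathcomp Require Import all_boot all_order all_algebra.
From mathcomp Require Import reals.
From mathcomp Require Import complex mxtens.
From mathcomp Require Import ring zify.
Set Implicit Arguments.
Unset Strict Implicit.
Unset Printing Implicit Defensive.
Import Order.TTheory GRing.Theory Num.Theory.
Local Open Scope ring_scope.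

(** The torus [s1 ^ h1 * s2 ^ h2] scales [(e1, e2)] and preserves every form
invariant under [h1] and [h2], so the pair is principal exactly when its
centralizer has dimension [rk g]. The rank is computed on elements with a cyclic
vector, whose centralizer consists of polynomials ([odd] ones for [sp] and
[so]), and bounds every centralizer from below by semicontinuity.

After rescaling a weight basis, [e1] and [e2] act as the two shifts [J1], [J2]
of the grids [n_i] x [m_i]. Multiplying an element [X] of the centralizer by the
inverse form turns commutation into the Hankel-type equations
[J S + S J^T = 0], and membership in [g] into symmetry or antisymmetry of [S].
A solution is determined by one free coefficient for each [(a, b)] with
[a < min n_i n_j] and [b < min m_i m_j], on each pair of blocks [(i, j)], while
symmetry identifies [(i, j)] with [(j, i)] and fixes the parity of [a + b] on the
diagonal blocks. The theorem follows by comparing this count with [rk g]. *)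

(** * Ranks via cyclic elements *)

(** The form is arbitrary, so a cyclic element of [sp] or [so] is built by splitting off hyperbolic
    planes and giving each a fresh pair of opposite eigenvalues. Semisimple elements are chosen
    because a nilpotent of [so] in positive even dimension never has a cyclic vector.

    The parity conditions have two sources. On a single block the inverse form is itself an
    invertible solution of the Hankel equations, and such a solution exists only for one parity of n
    + m. On several blocks they come from rounding: the rank is the half of dim V rounded down,
    while a diagonal block contributes the half of n_i m_i, rounded up for [sp] and down for [so].
    Every pair of blocks costs at least one more dimension. Rounding up leaves no room for that;
    rounding down gains at most 1/2 per block, which pays for two blocks only, and then only if both
    products are odd and the pair costs exactly 1.

    For [sl] no form is given, and a signed reversal of each grid takes its place in the passage to
    the Hankel equations. *)

(** The functionals indexed by [P] separate [U] and have dual vectors in it, so they identify [U]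
    with the space of functions on [P]. The centralizers below are measured this way. *)
Lemma dim_coord (F : fieldType) (V : vectType F) (U : {vspace V})
    (T : finType) (P : {pred T}) (f : V -> T -> F) :
  (forall t a u v, f (a *: u + v) t = a * f u t + f v t) ->
  (forall v, v \in U -> (forall t, t \in P -> f v t = 0) -> v = 0) ->
  (forall t, t \in P ->
    exists2 v, v \in U & forall s, s \in P -> f v s = (s == t)%:R) ->
  \dim U = #|P|.
Proof.
move=> flin finj fsurj.
pose phi v : 'rV[F]_#|P| := \row_k f v (enum_val k).
have phil : linear phi.
  by move=> a u v; apply/rowP => k; rewrite !mxE flin.
pose phiL := GRing.isLinear.Build _ _ _ _ phi phil.
pose g : {linear V -> 'rV[F]_#|P|} := HB.pack phi phiL.
have gE v : linfun g v = phi v by rewrite lfunE.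
rewrite -(@limg_dim_eq _ _ _ (linfun g)); last first.
  apply/eqP; rewrite -subv0; apply/subvP => v; rewrite memv_cap memv_ker gE.
  case/andP=> vU /eqP/rowP v0; rewrite memv0; apply/eqP/finj => // t tP.
  by have := v0 (enum_rank_in tP t); rewrite !mxE enum_rankK_in.
suff -> : (linfun g @: U)%VS = fullv by rewrite dimvf /dim/= mul1n.
apply/eqP; rewrite eqEsubv subvf /=; apply/subvP => w _.
have -> : w = \sum_k w 0 k *: delta_mx 0 k by rewrite [LHS]matrix_sum_delta big_ord1.
apply: memv_suml => k _; apply: memvZ.
have [v vU vk] := fsurj _ (enum_valP k).
suff -> : delta_mx 0 k = linfun g v by apply: memv_img.
rewrite gE; apply/rowP => l; rewrite !mxE vk ?enum_valP//=.
by rewrite (inj_eq enum_val_inj).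
Qed.

Lemma exists_nonroot (F : numFieldType) (q : {poly F}) :
  q != 0 -> exists t, q.[t] != 0.
Proof.
move=> q0; pose s := [seq i%:R : F | i <- iota 0 (size q)].
have us : uniq s by rewrite map_inj_uniq ?iota_uniq//; exact: mulrIn (oner_neq0 F).
have [|/allPn[t _ tq]] := boolP (all (root q) s); last by exists t.
by move=> /(max_poly_roots q0)/(_ us); rewrite size_map size_iota ltnn.
Qed.

Lemma det_pencil_poly (F : comNzRingType) n (A B : 'M[F]_n) :
  exists q : {poly F}, forall t, q.[t] = \det (A + t *: B).
Proof.
exists (\det (map_mx polyC A + 'X *: map_mx polyC B)) => t.
rewrite -[LHS]/(horner_eval t _) -det_map_mx; congr (\det _).
by apply/matrixP => i j; rewrite !mxE /= /horner_eval hornerD hornerM hornerX !hornerC.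
Qed.

(* A minor of [f] on [g] that is nonzero at [t = 0] stays nonzero for generic
   [t], so kernels can only get larger in special position. *)
Lemma dim_lker_semicont (F : fieldType) (V W : vectType F) (g : {vspace V})
    (f h : 'Hom(V, W)) :
  exists2 q : {poly F}, q != 0 & forall t, q.[t] != 0 ->
    (\dim (g :&: lker (f + t *: h)%R) <= \dim (g :&: lker f))%N.
Proof.
pose b := vbasis (f @: g)%VS; set r := \dim (f @: g)%VS in b.
have bb : basis_of (f @: g)%VS b := vbasisP _.
have /fin_all_exists[u uP] : forall i : 'I_r, exists v, v \in g /\ f v = b`_i.
  move=> i; have : b`_i \in (f @: g)%VS.
    by rewrite vbasis_mem// mem_nth// size_tuple.
  by move=> /memv_imgP[v vg ->]; exists v.
(* [f (u i)] is the i-th basis vector of the image, so [1%:M + t *: D] collects the values of the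
   coordinates along [b] at [(f + t *: h) (u i)]. A nonzero determinant keeps these vectors
   independent. *)
pose D : 'M[F]_r := \matrix_(i, j) coord b j (h (u i)).
have [q qE] := det_pencil_poly 1%:M D.
exists q => [|t].
  apply/negP => /eqP q0; have := qE 0; rewrite q0 horner0 scale0r addr0 det1.
  by move/eqP; rewrite eq_sym oner_eq0.
rewrite qE => dett.
suff le : (r <= \dim ((f + t *: h)%R @: g))%N.
  have aux a1 b1 a2 b2 k :
      (b1 + a1 = k)%N -> (b2 + a2 = k)%N -> (a1 <= a2)%N -> (b2 <= b1)%N.
    by move=> <- e lea; rewrite -(leq_add2r a1) -e leq_add2l.
  exact: aux (limg_ker_dim f g) (limg_ker_dim (f + t *: h) g) le.
pose w := [tuple (f + t *: h) (u i) | i < r].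
have cw (i j : 'I_r) : coord b j w`_i = (1%:M + t *: D) i j.
  rewrite (nth_map i) ?size_enum_ord// nth_ord_enum add_lfunE scale_lfunE.
  have [_ ->] := uP i.
  by rewrite linearD linearZ /= coord_free ?(basis_free bb)// !mxE eq_sym.
have fw : free w.
  apply/freeP => k k0 i; have : \row_i k i = 0.
    have uM : 1%:M + t *: D \in unitmx by rewrite unitmxE unitfE.
    rewrite -[LHS](mulmxK uM) -[RHS](mulmxK uM); congr (_ *m _); rewrite mul0mx.
    apply/rowP => j; rewrite !mxE.
    transitivity (coord b j (\sum_i k i *: w`_i)); last by rewrite k0 linear0.
    rewrite linear_sum; apply: eq_bigr => l _.
    by rewrite linearZ /= cw mxE.
  by move/rowP/(_ i); rewrite !mxE.
move: fw => /eqP; rewrite size_tuple => <-; apply: dimvS; apply/span_subvP => v.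
by move=> /mapP[i _ ->]; apply: memv_img; have [] := uP i.
Qed.

Section RankSemicontinuity.
Variable R : realType.
Local Notation C := (R[i]).

Lemma cent_glE N (x X : 'M[C]_N) : (X \in cent_gl x) = (X *m x == x *m X).
Proof.
have lin : linear (fun X : 'M[C]_N => lie X x).
  by move=> a u v; rewrite /lie mulmxDl mulmxDr -scalemxAl -scalemxAr scalerBr opprD addrACA.
pose lL := GRing.isLinear.Build _ _ _ _ _ lin.
pose g : {linear 'M[C]_N -> 'M[C]_N} := HB.pack (fun X : 'M[C]_N => lie X x) lL.
by rewrite memv_ker -[linfun _]/(linfun g) lfunE /= subr_eq0.
Qed.

Lemma gl_formE N (B X : 'M[C]_N) : (X \in gl_form B) = (X^T *m B + B *m X == 0).
Proof.
have lin : linear (fun X : 'M[C]_N => X^T *m B + B *m X).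
  move=> a u v; rewrite linearP /= mulmxDl mulmxDr -scalemxAl -scalemxAr scalerDr.
  by rewrite addrACA.
pose lL := GRing.isLinear.Build _ _ _ _ _ lin.
pose g : {linear 'M[C]_N -> 'M[C]_N} := HB.pack (fun X : 'M[C]_N => X^T *m B + B *m X) lL.
by rewrite memv_ker -[linfun _]/(linfun g) lfunE.
Qed.

Lemma gl_slE N (X : 'M[C]_N) : (X \in gl_sl R N) = (\tr X == 0).
Proof.
have lin : linear (fun X : 'M[C]_N => (\tr X)%:M : 'M[C]_1).
  by move=> a u v; rewrite linearP /= raddfD /= scale_scalar_mx.
pose lL := GRing.isLinear.Build _ _ _ _ _ lin.
pose g : {linear 'M[C]_N -> 'M[C]_1} := HB.pack (fun X : 'M[C]_N => (\tr X)%:M : 'M[C]_1) lL.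
rewrite memv_ker -[linfun _]/(linfun g) lfunE /=.
apply/eqP/eqP => [/matrixP/(_ 0 0)|->]; last exact: raddf0.
by rewrite !mxE eqxx.
Qed.

Lemma dim_cent_semicont N (g : {vspace 'M[C]_N}) (x z : 'M[C]_N) :
  exists2 q : {poly C}, q != 0 & forall t, q.[t] != 0 ->
    (\dim (g :&: cent_gl (x + t *: z)) <= \dim (g :&: cent_gl x))%N.
Proof.
have lin y : linear (fun X : 'M[C]_N => lie X y).
  by move=> a u v; rewrite /lie mulmxDl mulmxDr -scalemxAl -scalemxAr scalerBr opprD addrACA.
pose lL y := GRing.isLinear.Build _ _ _ _ _ (lin y).
pose l y : {linear 'M[C]_N -> 'M[C]_N} := HB.pack (fun X : 'M[C]_N => lie X y) (lL y).
have centE y : cent_gl y = lker (linfun (l y)).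
  by apply/vspaceP => X; rewrite [LHS]cent_glE [RHS]memv_ker lfunE /= subr_eq0.
have [q q0 qP] := dim_lker_semicont g (linfun (l x)) (linfun (l z)).
have addE t : linfun (l x) + t *: linfun (l z) = linfun (l (x + t *: z)).
  apply/lfunP => X; rewrite add_lfunE scale_lfunE !lfunE /= /lie.
  by rewrite mulmxDr mulmxDl -scalemxAl -scalemxAr opprD scalerBr addrACA.
have key t y : q.[t] != 0 -> linfun (l x) + t *: linfun (l z) = linfun (l y) ->
    (\dim (g :&: cent_gl y) <= \dim (g :&: cent_gl x))%N.
  by move=> /qP qt e; rewrite !centE -e.
exists q; first exact: q0.
move=> t qt; exact: (key t _ qt (addE t)).
Qed.

(** Invertible exactly when [v] is a cyclic vector of [x]. *)
Definition krylov N (x : 'M[C]_N) (v : 'cV[C]_N) : 'M[C]_N :=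
  \matrix_(i, j) (x ^+ j *m v) i 0.

Lemma krylov_pencil_poly N (x z : 'M[C]_N) (v : 'cV[C]_N) :
  exists q : {poly C}, forall t, q.[t] = \det (krylov (x + t *: z) v).
Proof.
pose X := map_mx polyC x + 'X *: map_mx polyC z.
exists (\det (\matrix_(i, j < N) (X ^+ j *m map_mx polyC v) i 0)) => t.
rewrite -[LHS]/(horner_eval t _) -det_map_mx; congr (\det _).
have Xt k : map_mx (horner_eval t) (X ^+ k) = (x + t *: z) ^+ k.
  elim: k => [|k IH]; first by rewrite !expr0 map_mx1.
  rewrite !exprS map_mxM IH; congr (_ *m _).
  by apply/matrixP => i j; rewrite !mxE /= /horner_eval hornerD hornerM hornerX !hornerC.
apply/matrixP => i j; rewrite [RHS]mxE [LHS]mxE [X in _ X]mxE.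
transitivity ((map_mx (horner_eval t) (X ^+ j *m map_mx polyC v)) i 0).
  by rewrite [RHS]mxE; congr (_ _); exact: mxE.
rewrite map_mxM /= Xt !mxE; apply: eq_bigr => k _.
by rewrite !mxE /= /horner_eval hornerC.
Qed.

(** On the line from [x] to [x0], cyclicity of [v0] is the nonvanishing of a polynomial that is
    nonzero at 1, and semicontinuity at [x] holds off the roots of another one. A common nonroot
    gives an element of [g] with centralizer of dimension [r], which bounds that of [x] from
    below. *)
Lemma is_rank_cyclic N (g : {vspace 'M[C]_N}) r x0 v0 :
  x0 \in g -> krylov x0 v0 \in unitmx ->
  (forall x v, x \in g -> krylov x v \in unitmx -> \dim (g :&: cent_gl x) = r) ->
  is_rank g r.
Proof.
move=> x0g cx0 dimr; split; first by exists x0 => //; apply: dimr cx0.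
move=> x xg; have [q q0 qP] := dim_cent_semicont g x (x0 - x).
have [k kE] := krylov_pencil_poly x (x0 - x) v0.
have k0 : k != 0.
  apply/negP => /eqP k0; have := kE 1; rewrite k0 horner0 scale1r addrC subrK.
  by move: cx0; rewrite unitmxE unitfE => /[swap] <-; rewrite eqxx.
have [|t] := @exists_nonroot _ (q * k); first by rewrite mulf_neq0.
rewrite hornerM mulf_eq0 negb_or => /andP[/qP qt kt].
have yg : x + t *: (x0 - x) \in g by rewrite memvD// memvZ// memvB.
have uy : krylov (x + t *: (x0 - x)) v0 \in unitmx.
  by rewrite unitmxE unitfE -kE.
by rewrite -(dimr _ _ yg uy); exact: qt.
Qed.

End RankSemicontinuity.

Section CyclicCentralizer.
Variable R : realType.
Local Notation C := (R[i]).

Lemma krylov_comm N (x Y : 'M[C]_N) v :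
  Y *m x = x *m Y -> Y *m krylov x v = krylov x (Y *m v).
Proof.
move=> Yx; apply/matrixP => i j; rewrite [LHS]mxE [RHS]mxE.
have -> : x ^+ j *m (Y *m v) = Y *m (x ^+ j *m v).
  by rewrite !mulmxA; congr (_ *m _); apply/esym/(commrX j Yx).
by rewrite [RHS]mxE; apply: eq_bigr => k _; rewrite mxE.
Qed.

(** Commuting with [x] propagates the value at [v] to all [x ^+ j *m v], and these span. *)
Lemma krylov_inj N (x Y Z : 'M[C]_N) v : krylov x v \in unitmx ->
  Y *m x = x *m Y -> Z *m x = x *m Z -> Y *m v = Z *m v -> Y = Z.
Proof.
move=> uK Yx Zx YZ; apply: (can_inj (mulmxK uK)).
by rewrite /= krylov_comm// krylov_comm// YZ.
Qed.

(** The centralizer of [x] consists of polynomials in [x]. [P] selects the powers lying in [g]; as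
    the span of the remaining powers meets [g] only in 0, the selected ones form a basis. *)
Lemma dim_cent_cyclic N (g : {vspace 'M[C]_N}) x v (P : {pred 'I_N}) :
  krylov x v \in unitmx -> (forall j, j \in P -> x ^+ j \in g) ->
  (forall c : 'I_N -> C, \sum_(j | j \notin P) c j *: x ^+ j \in g ->
      \sum_(j | j \notin P) c j *: x ^+ j = 0) ->
  \dim (g :&: cent_gl x) = #|P|.
Proof.
move=> uK Pg nPg.
have comX j : x ^+ j *m x = x *m x ^+ j by rewrite -[LHS]exprSr -[RHS]exprS.
(* The coordinates of [Y *m v] in the Krylov basis are the coefficients of [Y] as a polynomial in
   [x]. *)
pose f (Y : 'M[C]_N) j := (invmx (krylov x v) *m (Y *m v)) j 0.
have fE (Y : 'M[C]_N) : Y *m x = x *m Y -> Y = \sum_j f Y j *: x ^+ j.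
  move=> Yx; apply: (krylov_inj uK Yx).
    by rewrite mulmx_suml mulmx_sumr; apply: eq_bigr => j _;
       rewrite -scalemxAl -scalemxAr comX.
  rewrite mulmx_suml -[LHS](mulKVmx uK); apply/colP => i; rewrite mxE summxE.
  by apply: eq_bigr => j _; rewrite -scalemxAl [RHS]mxE mulrC [X in _ * X]mxE.
apply: (dim_coord (f := f)) => [j a Y Z|Y|j jP].
- by rewrite /f mulmxDl mulmxDr -scalemxAl -scalemxAr [LHS]mxE [X in X + _]mxE.
- rewrite memv_cap cent_glE => /andP[Yg /eqP Yx] Y0.
  have YE : Y = \sum_(j | j \notin P) f Y j *: x ^+ j.
    rewrite {1}(fE Y Yx) (bigID (fun j => j \in P)) /= big1 ?add0r// => j jP.
    by rewrite Y0// scale0r.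
  by have := nPg (f Y); rewrite -YE; apply.
- exists (x ^+ j); first by rewrite memv_cap Pg//= cent_glE comX.
  move=> i _; rewrite /f.
  have -> : x ^+ j *m v = col j (krylov x v) by apply/colP => k; rewrite !mxE.
  by rewrite colE mulKmx// !mxE eqxx andbT.
Qed.

(** Rank-nullity for the trace, which is nonzero at the identity. *)
Lemma dim_sl_cap N (U : {vspace 'M[C]_N}) : (0 < N)%N -> 1%:M \in U ->
  (\dim (U :&: gl_sl R N)).+1 = \dim U.
Proof.
move=> N0 U1; rewrite /gl_sl -[RHS](limg_ker_dim
  (linfun (fun X : 'M[C]_N => (\tr X)%:M : 'M[C]_1)) U) -addn1; congr (_ + _)%N.
have lin : linear (fun X : 'M[C]_N => (\tr X)%:M : 'M[C]_1).
  by move=> a u v; rewrite linearP /= raddfD /= scale_scalar_mx.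
pose lL := GRing.isLinear.Build _ _ _ _ _ lin.
pose g : {linear 'M[C]_N -> 'M[C]_1} := HB.pack (fun X : 'M[C]_N => (\tr X)%:M : 'M[C]_1) lL.
rewrite -[linfun _]/(linfun g).
suff -> : (linfun g @: U)%VS = fullv by rewrite dimvf /dim/= muln1.
apply/eqP; rewrite eqEsubv subvf /=; apply/subvP => w _.
have -> : w = linfun g ((w 0 0 / N%:R) *: 1%:M).
  rewrite lfunE /= mxtraceZ mxtrace1 mulfVK ?pnatr_eq0 -?lt0n//.
  by rewrite -mx11_scalar.
by apply/memv_img/memvZ.
Qed.

Lemma card_odd_ord N : #|[pred j : 'I_N | odd j]| = N./2.
Proof.
rewrite -sum1_card; elim: N => [|N IH]; first by rewrite big_ord0.
rewrite big_mkcond big_ord_recr /= -big_mkcond IH inE /= uphalf_half addnC.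
by case: (odd N).
Qed.

Lemma diag_mxX N (d : 'rV[C]_N) j : diag_mx d ^+ j = diag_mx (\row_i d 0 i ^+ j).
Proof.
elim: j => [|j IH].
  transitivity (1%:M : 'M[C]_N); first exact: expr0.
  by rewrite -diag_const_mx; congr diag_mx; apply/rowP => i; rewrite !mxE.
rewrite exprS IH [LHS]mulmx_diag; congr diag_mx.
by apply/rowP => i; rewrite !mxE exprS.
Qed.

Lemma krylov_diag_unit N (d : 'rV[C]_N) :
  injective (d 0) -> krylov (diag_mx d) (const_mx 1) \in unitmx.
Proof.
move=> dI; have -> : krylov (diag_mx d) (const_mx 1) = (Vandermonde N d)^T.
  apply/matrixP => i j; rewrite mxE diag_mxX mul_diag_mx !mxE mulr1.
  by [].
rewrite unitmx_tr unitmxE unitfE det_Vandermonde; apply/prodf_neq0 => i _.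
apply/prodf_neq0 => j ij; rewrite subr_eq0; apply/negP => /eqP/dI ji.
by rewrite ji ltnn in ij.
Qed.

Lemma is_rank_sl N : (0 < N)%N -> is_rank (gl_sl R N) N.-1.
Proof.
move=> N0; have dimc (y : 'M[C]_N) (u : 'cV[C]_N) : krylov y u \in unitmx -> \dim (cent_gl y) = N.
  move=> uy; rewrite -[X in \dim X]capfv (dim_cent_cyclic (P := predT) uy).
  - by rewrite card_ord.
  - by move=> j _; rewrite memvf.
  - by move=> c _; rewrite big_pred0.
(* Distinct eigenvalues 0, ..., N-1, shifted by their mean to make the trace vanish. *)
pose s : C := \sum_(i < N) i%:R.
pose d : 'rV[C]_N := \row_i (i%:R - s / N%:R).
have dI : injective (d 0).
  move=> i j; rewrite !mxE => /addIr/eqP; rewrite eqr_nat => /eqP; exact: val_inj.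
apply: (is_rank_cyclic _ (krylov_diag_unit dI)) => [|y u _ uy].
  rewrite gl_slE mxtrace_diag; under eq_bigr do rewrite mxE.
  rewrite big_split /= sumr_const card_ord -[X in _ + X]mulr_natr mulNr mulfVK ?subrr//.
  by rewrite pnatr_eq0 -lt0n.
have y1 : 1%:M \in cent_gl y by rewrite cent_glE mulmx1 mul1mx.
by rewrite capvC -[in RHS](dimc y u uy) -(dim_sl_cap N0 y1).
Qed.

Lemma gl_form_expmx N (B x : 'M[C]_N) j : x \in gl_form B ->
  (x ^+ j)^T *m B = (-1) ^+ j *: (B *m x ^+ j).
Proof.
rewrite gl_formE addr_eq0 => /eqP xB; elim: j => [|j IH].
  by rewrite !expr0 scale1r trmx1 mul1mx mulmx1.
rewrite exprS trmx_mul -mulmxA xB mulmxN mulmxA IH -scalemxAl -scaleN1r scalerA.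
rewrite -[-1 * _]exprS -mulmxA; congr (_ *: (_ *m _)).
by rewrite -[LHS]exprSr -[RHS]exprS.
Qed.

(** Odd powers of [x] are again skew for [B]. A combination of even powers is self-adjoint, so if it
    is also skew then twice it vanishes. *)
Lemma dim_cent_cyclic_form N (B x : 'M[C]_N) v : B \in unitmx ->
  x \in gl_form B -> krylov x v \in unitmx ->
  \dim (gl_form B :&: cent_gl x) = N./2.
Proof.
move=> uB xB uK; rewrite -card_odd_ord; apply: (dim_cent_cyclic uK) => [j|c].
  rewrite inE => jo; rewrite gl_formE gl_form_expmx// -signr_odd jo.
  by rewrite scaleN1r addNr.
set Z := \sum_(j | _) _; rewrite gl_formE.
have -> : Z^T *m B = B *m Z.
  rewrite linear_sum mulmx_suml mulmx_sumr; apply: eq_bigr => j.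
  rewrite inE => jo; rewrite linearZ /= -scalemxAl gl_form_expmx// -signr_odd.
  by rewrite (negPf jo) scale1r scalemxAr.
rewrite -mulr2n -scaler_nat scaler_eq0 pnatr_eq0 /= => /eqP BZ.
by rewrite -[Z](mulKmx uB) BZ mulmx0.
Qed.

End CyclicCentralizer.

(** * Isotropic vectors, hyperbolic planes and the ranks of [sp] and [so] *)

Lemma mx11E (F : Type) (A B : 'M[F]_1) : A 0 0 = B 0 0 -> A = B.
Proof. by move=> AB; apply/matrixP => i j; rewrite !ord1. Qed.

(** On the plane of the first two basis vectors, either the second one is isotropic or
    [e0 + s *: e1] is, for [s] a root of a genuine quadratic equation. *)
Lemma exists_isotropic (F : closedFieldType) k (B : 'M[F]_k.+2) :
  exists2 v : 'cV[F]_k.+2, v != 0 & v^T *m B *m v = 0.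
Proof.
pose e0 : 'cV[F]_k.+2 := delta_mx 0 0.
pose e1 : 'cV[F]_k.+2 := delta_mx (lift 0 0) 0.
have q i j : (delta_mx i 0 : 'cV[F]_k.+2)^T *m B *m delta_mx j 0 = (B i j)%:M.
  apply: mx11E; rewrite trmx_delta -mulmxA -colE -rowE !mxE.
  by [].
have [B11|B11] := eqVneq (B (lift 0 0) (lift 0 0)) 0.
  exists e1; last by rewrite q B11 raddf0.
  by apply/negP => /eqP/colP/(_ (lift 0 0)); rewrite !mxE !eqxx => /eqP; rewrite oner_eq0.
pose b00 := B 0 0; pose b := B 0 (lift 0 0) + B (lift 0 0) 0.
pose b11 := B (lift 0 0) (lift 0 0).
have [s sE] := solve_monicpoly (fun i => if i == 0 then - b00 / b11 else - b / b11) (isT : 0 < 2)%N.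
exists (e0 + s *: e1).
  apply/negP => /eqP/colP/(_ 0); rewrite !mxE !eqxx /= mulr0 addr0 => /eqP.
  by rewrite oner_eq0.
rewrite [(_ + _)^T]linearD /= [(s *: _)^T]linearZ /= !(mulmxDl, mulmxDr) -!(scalemxAl, scalemxAr) !q.
apply: mx11E; rewrite !mxE !mulr1n.
move: sE; rewrite !big_ord_recl big_ord0 /= expr0 expr1 addr0 mulr1 => sE.
transitivity (b00 + b * s + b11 * s ^+ 2); first by rewrite /b /b00 /b11; ring.
by rewrite sE; field; rewrite /b11.
Qed.

Section Hyperbolic.
Variables (F : numClosedFieldType) (eps : F).
Hypothesis eps2 : eps * eps = 1.

Lemma exists_hyperbolic k (B : 'M[F]_k.+2) :
  B^T = eps *: B -> B \in unitmx ->
  exists U : 'M[F]_(k.+2, 1 + 1),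
    U^T *m B *m U = block_mx 0 1%:M eps%:M 0.
Proof.
move=> Bsym uB; have [v v0 vv] := exists_isotropic B.
have [w0 vw0] : exists w0 : 'cV[F]_k.+2, v^T *m B *m w0 = 1%:M.
  have : v^T *m B != 0.
    apply/negP => /eqP vB; move: v0; rewrite -[v]trmxK -[v^T](mulmxK uB) vB.
    by rewrite mul0mx trmx0 eqxx.
  case/rV0Pn => j uj; exists (((v^T *m B) 0 j)^-1 *: delta_mx j 0).
  apply: mx11E; rewrite -scalemxAr -colE !mxE mulVf//.
  by move: uj; rewrite mxE.
have tq (x y : 'cV[F]_k.+2) : y^T *m B *m x = eps *: (x^T *m B *m y).
  transitivity ((y^T *m B *m x)^T); first by apply: mx11E; rewrite [RHS]mxE.
  by rewrite !trmx_mul trmxK Bsym -scalemxAl -scalemxAr mulmxA.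
pose s := (w0^T *m B *m w0) 0 0.
have ss : w0^T *m B *m w0 = s%:M by exact: mx11_scalar.
have es : eps * s = s.
  have /matrixP/(_ 0 0) := tq w0 w0; rewrite ss !mxE eqxx !mulr1n => e; exact: esym e.
(* Subtracting a multiple of the isotropic [v] keeps the pairing with [v] equal to 1. The cross
   terms contribute [s / 2] and [eps * s / 2], which add up to [s] because [eps * s = s]. *)
pose w := w0 - (s / 2%:R) *: v.
have vw : v^T *m B *m w = 1%:M.
  by rewrite mulmxBr -scalemxAr vv scaler0 subr0 vw0.
have wv : w^T *m B *m v = eps%:M by rewrite tq vw scale_scalar_mx mulr1.
have ww : w^T *m B *m w = 0.
  rewrite {2}/w mulmxBr -scalemxAr wv /w linearB linearZ /= !mulmxBl -!scalemxAl.
  rewrite vw0 ss; apply: mx11E; rewrite !mxE /= !mulr1n.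
  have -> : s / 2 * eps = s / 2 by rewrite mulrAC (mulrC s) es.
  by field.
exists (row_mx v w).
by rewrite tr_row_mx mul_col_mx mul_col_row vv vw wv ww.
Qed.

Lemma hyperbolic_unit : block_mx (0 : 'M[F]_1) 1%:M eps%:M (0 : 'M[F]_1) \in unitmx.
Proof.
have : block_mx (0 : 'M[F]_1) 1%:M eps%:M (0 : 'M[F]_1) *m
    block_mx (0 : 'M[F]_1) eps%:M 1%:M (0 : 'M[F]_1) = 1%:M.
  rewrite mulmx_block !mulmx0 !mul0mx !mulmx1 !addr0 !add0r mul_scalar_mx.
  by rewrite scale_scalar_mx eps2 -scalar_mx_block.
by case/mulmx1_unit.
Qed.

Lemma hyperbolic_split k (B : 'M[F]_(2 + k)) :
  B^T = eps *: B -> B \in unitmx ->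
  exists Q : 'M[F]_(2 + k), exists B2 : 'M[F]_k,
    [/\ Q \in unitmx, B2^T = eps *: B2, B2 \in unitmx &
        Q^T *m B *m Q = block_mx (block_mx 0 1%:M eps%:M 0 : 'M_(1 + 1)) 0 0 B2].
Proof.
move=> Bsym uB; have [U UE] := exists_hyperbolic Bsym uB.
set h := block_mx _ _ _ _ in UE *; have uh : h \in unitmx := hyperbolic_unit.
have [K freeK AK] : exists2 K : 'M[F]_(2 + k, k),
    row_free K^T & U^T *m B *m K = 0.
  (* The orthogonal complement of the plane has dimension [k] because [U^T *m B] has full rank, its
     product with [U] being invertible. *)
  have rk : \rank (kermx (U^T *m B)^T) = k.
    rewrite mxrank_ker mxrank_tr; suff -> : \rank (U^T *m B) = 2 by rewrite addKn.
    apply/eqP; rewrite eqn_leq rank_leq_row /=.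
    by have := mxrankM_maxl (U^T *m B) U; rewrite UE mxrank_unit.
  have := row_base_free (kermx (U^T *m B)^T).
  have : row_base (kermx (U^T *m B)^T) *m (U^T *m B)^T = 0.
    by apply/sub_kermxP; rewrite eq_row_base.
  move: (row_base _); rewrite rk => K K0 fK.
  exists K^T; first by rewrite trmxK.
  by apply: trmx_inj; rewrite trmx_mul trmxK trmx0 K0.
have KU : K^T *m B *m U = 0.
  apply: trmx_inj; rewrite !trmx_mul trmxK Bsym -scalemxAl -scalemxAr mulmxA AK.
  by rewrite scaler0 trmx0.
pose Q : 'M[F]_(2 + k) := row_mx U K; pose B2 := K^T *m B *m K.
have QE : Q^T *m B *m Q = block_mx h 0 0 B2.
  by rewrite tr_row_mx mul_col_mx mul_col_row UE AK KU.
(* Pair a relation between the columns of [U] and [K] with [U]: the [K] part drops out by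
   orthogonality, and the invertible Gram matrix [h] kills the [U] part. *)
have uQ : Q \in unitmx.
  rewrite -unitmx_tr -row_free_unit -kermx_eq0; apply/eqP.
  set Z := kermx _; have := mulmx_ker Q^T; rewrite -/Z -[Z]hsubmxK tr_row_mx.
  rewrite mul_row_col => Z0.
  have Z1 : lsubmx Z = 0.
    apply: (can_inj (mulmxK uh)); rewrite /= mul0mx -UE.
    have /(congr1 (mulmx^~ (B *m U))) := Z0.
    by rewrite mul0mx mulmxDl -!mulmxA [K^T *m _]mulmxA KU mulmx0 addr0.
  move: Z0; rewrite Z1 mul0mx add0r => Z2.
  suff -> : rsubmx Z = 0 by rewrite row_mx0.
  by apply: (row_free_inj freeK); rewrite Z2 mul0mx.
exists Q, B2; split => //.
- by rewrite !trmx_mul trmxK Bsym -scalemxAl -scalemxAr mulmxA.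
- have : block_mx h 0 0 B2 \in unitmx by rewrite -QE !unitmx_mul unitmx_tr uQ uB.
  by rewrite unitmxE det_ublock unitrM => /andP[_]; rewrite -unitmxE.
Qed.

(** The last equation says that [P *m diag_mx d *m invmx P] is skew for [B]. A hyperbolic plane with
    eigenvalues [c] and [- c] is split off at each stage of the induction; the bound on the entries
    is carried along so that a fresh [c] can be chosen. *)
Lemma exists_form_eigenbasis N (B : 'M[F]_N) :
  B^T = eps *: B -> B \in unitmx ->
  exists P : 'M[F]_N, exists d : 'rV[F]_N,
    [/\ P \in unitmx, injective (d 0), forall i, `|d 0 i| <= N%:R &
        diag_mx d *m (P^T *m B *m P) + (P^T *m B *m P) *m diag_mx d = 0].
Proof.
elim/ltn_ind: N B => -[|[|k]] IH B Bsym uB.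
- exists 1%:M, 0; split; rewrite ?unitmx1//; try by case.
  by apply/matrixP; case.
- exists 1%:M, 0; split; rewrite ?unitmx1//.
  + by move=> i j _; rewrite !ord1.
  + by move=> i; rewrite mxE normr0.
  + by rewrite (_ : diag_mx 0 = 0) ?mul0mx ?mulmx0 ?addr0//; exact: raddf0.
have [Q [B2 [uQ B2s uB2 QE]]] := @hyperbolic_split k B Bsym uB.
have [P2 [d2 [uP2 d2I d2le P2E]]] := IH k (leqnSn _) B2 B2s uB2.
(* Strictly larger than the moduli of the entries of [d2], which are at most [k]. *)
pose c : F := k.+2%:R.
pose d1 : 'rV[F]_(1 + 1) := row_mx c%:M (- c)%:M.
pose d : 'rV[F]_(2 + k) := row_mx d1 d2.
pose P : 'M[F]_(2 + k) := Q *m block_mx 1%:M 0 0 P2.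
have c0 : 0 < c by rewrite ltr0n.
have d2c i : `|d2 0 i| < c by apply: le_lt_trans (d2le i) _; rewrite ltr_nat.
have nc : `|c| = c by rewrite ger0_norm// ltW.
have dl (i : 'I_(1 + 1)) : d 0 (lshift k i) = d1 0 i by exact: row_mxEl.
have dr (i : 'I_k) : d 0 (rshift 2 i) = d2 0 i by exact: row_mxEr.
have d1l : d1 0 (lshift 1 0) = c by rewrite row_mxEl mxE eqxx.
have d1r : d1 0 (rshift 1 0) = - c by rewrite row_mxEr mxE eqxx.
have d1E i : d1 0 i = c \/ d1 0 i = - c.
  by case: (split_ordP i) => j ->; rewrite ord1 ?d1l ?d1r; [left|right].
have d1n i : `|d1 0 i| = c by case: (d1E i) => ->; rewrite ?normrN.
have cNc : c != - c by rewrite -subr_eq0 opprK -mulr2n mulrn_eq0 /= gt_eqF.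
exists P, d; split.
- rewrite unitmx_mul uQ /=.
  suff: block_mx (1%:M : 'M[F]_2) 0 0 P2 *m block_mx 1%:M 0 0 (invmx P2) = 1%:M by case/mulmx1_unit.
  by rewrite mulmx_block !mulmx0 !mul0mx mulmx1 mulmxV// !addr0 !add0r -scalar_mx_block.
- move=> i j; case: (@split_ordP 2 k i) => i' ->; case: (@split_ordP 2 k j) => j' ->;
    rewrite ?dl ?dr => e.
  + suff -> : i' = j' by [].
    move: e; case: (@split_ordP 1 1 i') (@split_ordP 1 1 j') => i0 -> [] j0 ->;
      rewrite !ord1 ?d1l ?d1r // => e0.
      by case/eqP: cNc.
    by case/eqP: cNc; rewrite e0.
  + by have := d2c j'; rewrite -e d1n ltxx.
  + by have := d2c i'; rewrite e d1n ltxx.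
  + by rewrite (d2I i' j' e).
- move=> i; case: (@split_ordP 2 k i) => i' ->; rewrite ?dl ?dr.
    by rewrite d1n lexx.
  exact: ltW.
have -> : P^T *m B *m P = block_mx (block_mx 0 1%:M eps%:M 0 : 'M_(1 + 1)) 0 0 (P2^T *m B2 *m P2).
  rewrite /P trmx_mul -!mulmxA [Q^T *m _]mulmxA [Q^T *m B *m _]mulmxA QE.
  rewrite tr_block_mx !trmx0 trmx1 !mulmx_block !mulmx0 !mul0mx !mulmx1 !mul1mx.
  by rewrite !(addr0, add0r, mulmx0) mulmxA.
have d1D : diag_mx d1 = block_mx c%:M 0 0 (- c)%:M.
  have D x : diag_mx (x%:M : 'M[F]_1) = x%:M.
    by apply: mx11E; rewrite !mxE eqxx.
  by rewrite /d1 diag_mx_row !D.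
have dD : diag_mx d = block_mx (diag_mx d1) 0 0 (diag_mx d2) by exact: diag_mx_row.
rewrite dD; set h := block_mx 0 1%:M _ _; set G := P2^T *m B2 *m P2 in P2E *.
suff key : block_mx (diag_mx d1) 0 0 (diag_mx d2) *m block_mx h 0 0 G
    + block_mx h 0 0 G *m block_mx (diag_mx d1) 0 0 (diag_mx d2) = 0 by exact: key.
rewrite !mulmx_block !mulmx0 !mul0mx !addr0 !add0r add_block_mx P2E !addr0.
rewrite d1D !mulmx_block !mulmx0 !mul0mx !addr0 !add0r add_block_mx !addr0.
rewrite !mulmx1 !mul1mx !mul_scalar_mx !scale_scalar_mx -!raddfD /=.
by rewrite mulNr [eps * c]mulrC subrr addNr !raddf0 !block_mx0.
Qed.

End Hyperbolic.

Lemma form_conj (F : comUnitRingType) N (P B D : 'M[F]_N) :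
  P \in unitmx -> D^T = D ->
  D *m (P^T *m B *m P) + (P^T *m B *m P) *m D = 0 ->
  (P *m D *m invmx P)^T *m B + B *m (P *m D *m invmx P) = 0.
Proof.
move=> uP DT e; have uPT : P^T \in unitmx by rewrite unitmx_tr.
apply: (can_inj (mulKmx uPT)); apply: (can_inj (mulmxK uP)).
rewrite /= mulmx0 mul0mx -[RHS]e mulmxDr mulmxDl !trmx_mul DT !mulmxA.
by rewrite -[P^T *m _]trmx_mul mulVmx// trmx1 mul1mx mulmxKV.
Qed.

Section RankForm.
Variable R : realType.
Local Notation C := (R[i]).

Lemma krylov_conj N (P x : 'M[C]_N) v : P \in unitmx ->
  krylov (P *m x *m invmx P) (P *m v) = P *m krylov x v.
Proof.
move=> uP; have conjX j : (P *m x *m invmx P) ^+ j *m P = P *m x ^+ j.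
  elim: j => [|j IH]; first by rewrite !expr0 mul1mx mulmx1.
  rewrite !exprS; transitivity (P *m x *m invmx P *m ((P *m x *m invmx P) ^+ j *m P)).
    by rewrite !mulmxA.
  by rewrite IH -!mulmxA mulKmx.
apply/matrixP => i j; rewrite [LHS]mxE [RHS]mxE mulmxA conjX -mulmxA mxE.
by apply: eq_bigr => k _; rewrite [krylov _ _ _ _]mxE.
Qed.

Lemma is_rank_form N (B : 'M[C]_N) eps : eps * eps = 1 ->
  B^T = eps *: B -> B \in unitmx -> is_rank (gl_form B) N./2.
Proof.
move=> eps2 Bsym uB.
have [P [d [uP dI _ dP]]] := exists_form_eigenbasis eps2 Bsym uB.
have uK : krylov (P *m diag_mx d *m invmx P) (P *m const_mx 1) \in unitmx.
  by rewrite krylov_conj// unitmx_mul uP krylov_diag_unit.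
apply: (is_rank_cyclic _ uK) => [|x v xB ux]; last exact: dim_cent_cyclic_form ux.
by rewrite gl_formE form_conj// tr_diag_mx.
Qed.

End RankForm.

(** * Coordinates on the model module *)

Section Coordinates.
Variables (p : nat) (n m : 'I_p -> nat).
Local Notation K := (model_dim n m).

(** An index [x] is the basis vector v_a (x) w_b of the block [blk x], with a = [ca x] and b =
    [cb x]. The coordinates are plain naturals so that they can be compared between different
    blocks. *)
Definition blk (x : 'I_K) : 'I_p := tag (tagnat.sig x).
Definition ca (x : 'I_K) : nat := tagged (tagnat.sig x) %/ m (blk x).
Definition cb (x : 'I_K) : nat := tagged (tagnat.sig x) %% m (blk x).
Definition pt (i : 'I_p) (a : 'I_(n i)) (b : 'I_(m i)) : 'I_K :=
  tagnat.rank (Tagged (fun i => 'I_(n i * m i)) (mxtens_index (a, b))).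

Lemma ca_lt x : (ca x < n (blk x))%N.
Proof. exact: mxtens_index_proof1. Qed.

Lemma cb_lt x : (cb x < m (blk x))%N.
Proof. exact: mxtens_index_proof2. Qed.

Lemma blk_pt i (a : 'I_(n i)) (b : 'I_(m i)) : blk (pt a b) = i.
Proof. by rewrite /blk /pt tagnat.rankK. Qed.

Lemma ca_pt i (a : 'I_(n i)) (b : 'I_(m i)) : ca (pt a b) = a.
Proof.
rewrite /ca /blk /pt tagnat.rankK /=.
have m0 : (0 < m i)%N by apply: leq_ltn_trans (ltn_ord b).
by rewrite divnMDl // divn_small ?addn0.
Qed.

Lemma cb_pt i (a : 'I_(n i)) (b : 'I_(m i)) : cb (pt a b) = b.
Proof.
rewrite /cb /blk /pt tagnat.rankK /=.
by rewrite modnMDl modn_small.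
Qed.

Lemma ptK (x : 'I_K) : pt (Ordinal (ca_lt x)) (Ordinal (cb_lt x)) = x.
Proof.
rewrite /pt -[RHS]tagnat.sigK; congr tagnat.rank.
rewrite [RHS]tagnat.sigE12; congr Tagged.
by apply: val_inj; rewrite /= -divn_eq.
Qed.

Lemma coord_inj x y : blk x = blk y -> ca x = ca y -> cb x = cb y -> x = y.
Proof.
rewrite -(ptK x) -(ptK y); move: (Ordinal _) (Ordinal _) (Ordinal _) (Ordinal _).
move: (blk x) (blk y) => i j a b a' b'; rewrite !blk_pt => ij; subst j.
by rewrite !ca_pt !cb_pt => /val_inj-> /val_inj->.
Qed.

Lemma exists_pt i a b : (a < n i)%N -> (b < m i)%N ->
  exists x, [/\ blk x = i, ca x = a & cb x = b].
Proof.
move=> an bm; exists (pt (Ordinal an) (Ordinal bm)).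
by rewrite blk_pt ca_pt cb_pt.
Qed.

Lemma big_coord (R : Type) (idx : R) (op : Monoid.com_law idx)
    (G : 'I_p -> nat -> nat -> R) :
  \big[op/idx]_(x : 'I_K) G (blk x) (ca x) (cb x) =
  \big[op/idx]_i \big[op/idx]_(a < n i) \big[op/idx]_(b < m i) G i a b.
Proof.
rewrite (reindex _ tagnat.rank_bij_on) /=.
under [RHS]eq_bigr => i _ do rewrite pair_big /=.
under [RHS]eq_bigr => i _.
  rewrite (reindex (@mxtens_unindex (n i) (m i))) /=; last first.
    by exists (@mxtens_index (n i) (m i)) => u _; rewrite (mxtens_indexK, mxtens_unindexK).
  over.
rewrite sig_big_dep /=; apply: eq_bigr => -[i k] _ /=.
by rewrite /ca /cb /blk tagnat.rankK.
Qed.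

(** Describing entries by a function [f] of naturals absorbs the transport along [blk x = blk y]
    hidden in the dependent block matrix. *)
Lemma mxdiagE (V : nmodType) (A : forall i, 'M[V]_(n i * m i)) (f : 'I_p -> nat -> nat -> V) :
  (forall i (u v : 'I_(n i * m i)), A i u v = f i u v) ->
  forall x y : 'I_K, (\mxdiag_i A i) x y =
    if blk x == blk y then f (blk x) (tagged (tagnat.sig x)) (tagged (tagnat.sig y)) else 0.
Proof.
move=> Af x y; rewrite mxE -/(blk x) -/(blk y).
case: eqVneq => [e|_]; last by rewrite mxE.
have aux k l (kl : k = l) (X : 'M[V]_k) (g : nat -> nat -> V) (u : 'I_k) (v : 'I_l) :
    (forall a b : 'I_k, X a b = g a b) -> conform_mx (0 : 'M_(k, l)) X u v = g u v.
  by subst l => Xg; rewrite conform_mx_id.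
by apply: aux => [|a b]; [rewrite -/(blk x) -/(blk y) e | exact: Af].
Qed.

Section Model.
Variables (R : realType) (A : forall k, 'M[R[i]]_k) (f : nat -> nat -> nat -> R[i]).
Hypothesis Af : forall k (i j : 'I_k), A k i j = f k i j.

Lemma model1E x y : model1 n m A x y =
  if [&& blk x == blk y & cb x == cb y] then f (n (blk x)) (ca x) (ca y) else 0.
Proof.
rewrite /model1 (mxdiagE (f := fun i u v =>
  if (u %% m i == v %% m i)%N then f (n i) (u %/ m i)%N (v %/ m i)%N else 0)) => [|i u v].
  by rewrite /cb /ca; case: eqVneq => //= ->.
by rewrite !mxE Af /= -val_eqE /=; case: eqP => _; rewrite (mulr1, mulr0).
Qed.

Lemma model2E x y : model2 n m A x y =
  if [&& blk x == blk y & ca x == ca y] then f (m (blk x)) (cb x) (cb y) else 0.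
Proof.
rewrite /model2 (mxdiagE (f := fun i u v =>
  if (u %/ m i == v %/ m i)%N then f (m i) (u %% m i)%N (v %% m i)%N else 0)) => [|i u v].
  by rewrite /cb /ca; case: eqVneq => //= ->.
by rewrite !mxE Af /= -val_eqE /=; case: eqP => _; rewrite (mul1r, mul0r).
Qed.
End Model.

Section Rescale.
Variable F : numFieldType.

(** The inverse of the product of the coefficients met when [sl2E] carries v_a to v_0. *)
Definition weight k a : F := \prod_(j < a) ((j.+1 * (k - j.+1))%:R)^-1.

Lemma weight_neq0 k a : (a < k)%N -> weight k a != 0.
Proof.
move=> ak; apply/prodf_neq0 => j _; rewrite invr_eq0 pnatr_eq0.
by rewrite muln_eq0 /= -lt0n subn_gt0 (leq_ltn_trans (ltn_ord j)).
Qed.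

Lemma weightS k a : (a.+1 < k)%N ->
  (a.+1 * (k - a.+1))%:R * weight k a.+1 = weight k a.
Proof.
move=> ak; rewrite /weight big_ord_recr /= mulrC mulfVK//.
by rewrite pnatr_eq0 muln_eq0 /= -lt0n subn_gt0.
Qed.

(* The diagonal change of basis that turns the coefficients [j * (k - j)] of [sl2E]
   into [1]. *)
Definition scaling : 'rV[F]_K :=
  \row_x (weight (n (blk x)) (ca x) * weight (m (blk x)) (cb x)).

(** Rows index targets, so [up1 x y] means that the first shift sends the vector at [y] to the one
    at [x]. *)
Definition up1 : rel 'I_K :=
  fun x y => [&& blk x == blk y, ca y == (ca x).+1 & cb y == cb x].
Definition up2 : rel 'I_K :=
  fun x y => [&& blk x == blk y, ca y == ca x & cb y == (cb x).+1].
Definition shift_mx (e : rel 'I_K) : 'M[F]_K := \matrix_(x, y) (e x y)%:R.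

Lemma scaling_unit : diag_mx scaling \in unitmx.
Proof.
rewrite unitmxE det_diag unitfE; apply/prodf_neq0 => x _.
by rewrite mxE mulf_neq0// weight_neq0 ?ca_lt ?cb_lt.
Qed.
End Rescale.

Lemma model1_sl2E (R : realType) :
  model1 n m (sl2E R) *m diag_mx (scaling _) = diag_mx (scaling _) *m shift_mx _ up1.
Proof.
apply/matrixP => x y; rewrite mul_mx_diag mul_diag_mx [LHS]mxE [RHS]mxE.
rewrite (model1E (f := fun k i j : nat => if j == i.+1 then (j * (k - j))%:R else 0)); last first.
  by move=> k i j; rewrite mxE.
rewrite !mxE /up1; case: eqVneq => [e|_] /=; last by rewrite mul0r mulr0.
rewrite [cb y == _]eq_sym; case: eqVneq => [eb|_] /=; last by rewrite andbF mul0r mulr0.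
case: eqVneq => [ea|_] /=; last by rewrite mul0r mulr0.
rewrite mulr1 ea -e -eb mulrA weightS//.
by rewrite -ea e ca_lt.
Qed.

Lemma model2_sl2E (R : realType) :
  model2 n m (sl2E R) *m diag_mx (scaling _) = diag_mx (scaling _) *m shift_mx _ up2.
Proof.
apply/matrixP => x y; rewrite mul_mx_diag mul_diag_mx [LHS]mxE [RHS]mxE.
rewrite (model2E (f := fun k i j : nat => if j == i.+1 then (j * (k - j))%:R else 0)); last first.
  by move=> k i j; rewrite mxE.
rewrite !mxE /up2; case: eqVneq => [e|_] /=; last by rewrite mul0r mulr0.
rewrite [ca y == _]eq_sym; case: eqVneq => [eb|_] /=; last by rewrite mul0r mulr0.
case: eqVneq => [ea|_] /=; last by rewrite mul0r mulr0.
rewrite mulr1 ea -e -eb mulrCA weightS//.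
by rewrite -ea e cb_lt.
Qed.

End Coordinates.

(** * The equations [J S + S J^T = 0] *)

Section Hankel.
Variables (F : numFieldType) (p : nat) (n m : 'I_p -> nat).
Hypotheses (n_gt0 : forall i, (0 < n i)%N) (m_gt0 : forall i, (0 < m i)%N).
Local Notation K := (model_dim n m).
Local Notation blk := (@blk p n m).
Local Notation ca := (@ca p n m).
Local Notation cb := (@cb p n m).
Local Notation up1 := (@up1 p n m).
Local Notation up2 := (@up2 p n m).

(** Entrywise, a unit step moved from one index of [S] to the other changes the sign; at the edge of
    a grid one of the two terms is missing and the other must vanish. *)
Definition hankel (S : 'M[F]_K) : Prop :=
  shift_mx F up1 *m S + S *m (shift_mx F up1)^T = 0 /\
  shift_mx F up2 *m S + S *m (shift_mx F up2)^T = 0.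

Lemma shift_mulE (e : rel 'I_K) (S : 'M[F]_K) x y z :
  (forall y', e x y' -> y' = y) -> e x y -> (shift_mx F e *m S) x z = S y z.
Proof.
move=> eU exy; rewrite mxE (bigD1 y) //= big1 ?addr0; first by rewrite mxE exy mul1r.
by move=> y' ny; rewrite mxE; case: (boolP (e x y')) => [/eU/eqP|_];
  [rewrite (negPf ny) | rewrite mul0r].
Qed.

Lemma shift_mul0 (e : rel 'I_K) (S : 'M[F]_K) x z :
  (forall y, ~~ e x y) -> (shift_mx F e *m S) x z = 0.
Proof. by move=> e0; rewrite mxE big1// => y _; rewrite mxE (negPf (e0 y)) mul0r. Qed.

Lemma shift_mul_trE (e : rel 'I_K) (S : 'M[F]_K) x z :
  (S *m (shift_mx F e)^T) x z = (shift_mx F e *m S^T) z x.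
Proof. by rewrite -[shift_mx F e *m S^T]trmxK trmx_mul trmxK [RHS]mxE. Qed.

Lemma up1_inj x y y' : up1 x y -> up1 x y' -> y' = y.
Proof.
move=> /and3P[/eqP e1 /eqP e2 /eqP e3] /and3P[/eqP f1 /eqP f2 /eqP f3].
by apply: coord_inj; rewrite -?e1 -?f1// ?e2 ?f2 ?e3 ?f3.
Qed.

Lemma up2_inj x y y' : up2 x y -> up2 x y' -> y' = y.
Proof.
move=> /and3P[/eqP e1 /eqP e2 /eqP e3] /and3P[/eqP f1 /eqP f2 /eqP f3].
by apply: coord_inj; rewrite -?e1 -?f1// ?e2 ?f2 ?e3 ?f3.
Qed.

Lemma up1_ex x : ((ca x).+1 < n (blk x))%N -> exists y, up1 x y.
Proof.
move=> lt; have [y [e1 e2 e3]] := exists_pt lt (cb_lt x).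
by exists y; apply/and3P; rewrite e1 e2 e3 !eqxx.
Qed.

Lemma up2_ex x : ((cb x).+1 < m (blk x))%N -> exists y, up2 x y.
Proof.
move=> lt; have [y [e1 e2 e3]] := exists_pt (ca_lt x) lt.
by exists y; apply/and3P; rewrite e1 e2 e3 !eqxx.
Qed.

Lemma up1_none x : (n (blk x) <= (ca x).+1)%N -> forall y, ~~ up1 x y.
Proof.
move=> le y; apply/negP => /and3P[/eqP e1 /eqP e2 _].
by have := ca_lt y; rewrite e2 -e1 ltnNge le.
Qed.

Lemma up2_none x : (m (blk x) <= (cb x).+1)%N -> forall y, ~~ up2 x y.
Proof.
move=> le y; apply/negP => /and3P[/eqP e1 _ /eqP e2].
by have := cb_lt y; rewrite e2 -e1 ltnNge le.
Qed.

Section Props.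
Variable S : 'M[F]_K.
Hypothesis SH : hankel S.

Lemma hankel1 x z : (shift_mx F up1 *m S) x z + (shift_mx F up1 *m S^T) z x = 0.
Proof. by have [/matrixP/(_ x z) + _] := SH; rewrite [X in X = _]mxE [X in _ = X]mxE shift_mul_trE. Qed.

Lemma hankel2 x z : (shift_mx F up2 *m S) x z + (shift_mx F up2 *m S^T) z x = 0.
Proof. by have [_ /matrixP/(_ x z)] := SH; rewrite [X in X = _]mxE [X in _ = X]mxE shift_mul_trE. Qed.

Lemma hankel1_step x x' z z' : up1 x x' -> up1 z z' -> S x' z = - S x z'.
Proof.
move=> ux uz; have := hankel1 x z.
rewrite (shift_mulE _ _ _ ux) => [|y]; last exact: up1_inj.
rewrite (shift_mulE _ _ _ uz) => [|y]; last exact: up1_inj.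
by rewrite mxE => /eqP; rewrite addr_eq0 => /eqP.
Qed.

Lemma hankel2_step x x' z z' : up2 x x' -> up2 z z' -> S x' z = - S x z'.
Proof.
move=> ux uz; have := hankel2 x z.
rewrite (shift_mulE _ _ _ ux) => [|y]; last exact: up2_inj.
rewrite (shift_mulE _ _ _ uz) => [|y]; last exact: up2_inj.
by rewrite mxE => /eqP; rewrite addr_eq0 => /eqP.
Qed.

Lemma hankel1_out x z z' : (n (blk x) <= (ca x).+1)%N -> up1 z z' -> S x z' = 0.
Proof.
move=> le uz; have := hankel1 x z; rewrite shift_mul0 ?add0r; last exact: up1_none.
by rewrite (shift_mulE _ _ _ uz) => [|y]; [rewrite mxE | exact: up1_inj].
Qed.

Lemma hankel2_out x z z' : (m (blk x) <= (cb x).+1)%N -> up2 z z' -> S x z' = 0.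
Proof.
move=> le uz; have := hankel2 x z; rewrite shift_mul0 ?add0r; last exact: up2_none.
by rewrite (shift_mulE _ _ _ uz) => [|y]; [rewrite mxE | exact: up2_inj].
Qed.

Lemma hankel1_outl x x' z : (n (blk z) <= (ca z).+1)%N -> up1 x x' -> S x' z = 0.
Proof.
move=> le ux; have := hankel1 x z; rewrite addrC shift_mul0 ?add0r; last exact: up1_none.
by rewrite (shift_mulE _ _ _ ux) => [|y]; last exact: up1_inj.
Qed.

Lemma hankel2_outl x x' z : (m (blk z) <= (cb z).+1)%N -> up2 x x' -> S x' z = 0.
Proof.
move=> le ux; have := hankel2 x z; rewrite addrC shift_mul0 ?add0r; last exact: up2_none.
by rewrite (shift_mulE _ _ _ ux) => [|y]; last exact: up2_inj.
Qed.

Lemma up1_pred z : (0 < ca z)%N -> exists z', up1 z' z.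
Proof.
move=> z0; have lt : ((ca z).-1 < n (blk z))%N by have := ca_lt z; lia.
have [y [e1 e2 e3]] := exists_pt lt (cb_lt z).
by exists y; apply/and3P; rewrite e1 e2 e3 prednK// !eqxx.
Qed.

Lemma up2_pred z : (0 < cb z)%N -> exists z', up2 z' z.
Proof.
move=> z0; have lt : ((cb z).-1 < m (blk z))%N by have := cb_lt z; lia.
have [y [e1 e2 e3]] := exists_pt (ca_lt z) lt.
by exists y; apply/and3P; rewrite e1 e2 e3 prednK// !eqxx.
Qed.

(** Moving a step from [z] to [x] only changes the sign. As the two coordinates add up to at least
    [n (blk x)], [z] can pay for every step until [x] is at the top of its grid, where [hankel1_out]
    applies. *)
Lemma hankel_vanish1 x z : (n (blk x) <= ca x + ca z)%N -> S x z = 0.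
Proof.
have [k] := ubnP (n (blk x) - ca x); elim: k x z => // k IH x z lek le.
have z0 : (0 < ca z)%N by have := ca_lt x; lia.
have [z' uz] := up1_pred z0.
have [le'|lt] := leqP (n (blk x)) (ca x).+1; first exact: hankel1_out uz.
have [x' ux] := up1_ex lt; have := hankel1_step ux uz.
move: ux uz => /and3P[/eqP e1 /eqP e2 /eqP e3] /and3P[/eqP f1 /eqP f2 /eqP f3].
rewrite IH => [/eqP||]; first by rewrite eq_sym oppr_eq0 => /eqP.
- by rewrite -e1 e2; have := ca_lt x; lia.
- by rewrite -e1 e2; lia.
Qed.

Lemma hankel_vanish2 x z : (m (blk x) <= cb x + cb z)%N -> S x z = 0.
Proof.
have [k] := ubnP (m (blk x) - cb x); elim: k x z => // k IH x z lek le.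
have z0 : (0 < cb z)%N by have := cb_lt x; lia.
have [z' uz] := up2_pred z0.
have [le'|lt] := leqP (m (blk x)) (cb x).+1; first exact: hankel2_out uz.
have [x' ux] := up2_ex lt; have := hankel2_step ux uz.
move: ux uz => /and3P[/eqP e1 /eqP e2 /eqP e3] /and3P[/eqP f1 /eqP f2 /eqP f3].
rewrite IH => [/eqP||]; first by rewrite eq_sym oppr_eq0 => /eqP.
- by rewrite -e1 e3; have := cb_lt x; lia.
- by rewrite -e1 e3; lia.
Qed.

Lemma hankel_shift1 k x x' z z' : blk x = blk x' -> blk z = blk z' ->
  ca x = (ca x' + k)%N -> ca z' = (ca z + k)%N -> cb x = cb x' -> cb z = cb z' ->
  S x z = (-1) ^+ k * S x' z'.
Proof.
elim: k x z => [|k IH] x z bx bz cx cz dx dz.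
  have -> : x = x' by apply: coord_inj => //; lia.
  have -> : z = z' by apply: coord_inj => //; lia.
  by rewrite mul1r.
have [|w uw] := @up1_pred x; first by lia.
have [|u uu] := @up1_ex z; first by have := ca_lt z'; rewrite -bz cz; lia.
rewrite (hankel1_step uw uu).
move: uu uw => /and3P[/eqP e1 /eqP e2 /eqP e3] /and3P[/eqP f1 /eqP f2 /eqP f3].
rewrite (IH w u) ?exprS ?mulN1r ?mulNr//; try congruence; lia.
Qed.

Lemma hankel_shift2 k x x' z z' : blk x = blk x' -> blk z = blk z' ->
  cb x = (cb x' + k)%N -> cb z' = (cb z + k)%N -> ca x = ca x' -> ca z = ca z' ->
  S x z = (-1) ^+ k * S x' z'.
Proof.
elim: k x z => [|k IH] x z bx bz cx cz dx dz.
  have -> : x = x' by apply: coord_inj => //; lia.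
  have -> : z = z' by apply: coord_inj => //; lia.
  by rewrite mul1r.
have [|w uw] := @up2_pred x; first by lia.
have [|u uu] := @up2_ex z; first by have := cb_lt z'; rewrite -bz cz; lia.
rewrite (hankel2_step uw uu).
move: uu uw => /and3P[/eqP e1 /eqP e2 /eqP e3] /and3P[/eqP f1 /eqP f2 /eqP f3].
rewrite (IH w u) ?exprS ?mulN1r ?mulNr//; try congruence; lia.
Qed.

Definition org i : 'I_K := pt (Ordinal (n_gt0 i)) (Ordinal (m_gt0 i)).

Lemma blk_org i : blk (org i) = i. Proof. exact: blk_pt. Qed.
Lemma ca_org i : ca (org i) = 0%N. Proof. exact: ca_pt. Qed.
Lemma cb_org i : cb (org i) = 0%N. Proof. exact: cb_pt. Qed.

(** All steps of [y] are handed over to the origin of block [i], one sign each. [y'] is the point of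
    block [i] with the coordinates of [y]. This links a pair of blocks with its transpose, where the
    symmetry of [S] enters. *)
Lemma hankel_swap i y y' : blk y' = i -> ca y' = ca y -> cb y' = cb y ->
  S y (org i) = (-1) ^+ (ca y + cb y) * S (org (blk y)) y'.
Proof.
move=> by' cy dy; have an : (ca y < n i)%N by rewrite -by' -cy ca_lt.
have [u [bu cu du]] := exists_pt an (m_gt0 i).
have [v [bv cv dv]] := exists_pt (n_gt0 (blk y)) (cb_lt y).
rewrite (@hankel_shift1 (ca y) y v (org i) u) ?blk_org ?ca_org ?cb_org ?bu ?bv ?du//; try lia.
rewrite (@hankel_shift2 (cb y) v (org (blk y)) u y') ?blk_org ?ca_org ?cb_org ?bu ?bv//; try lia.
  by rewrite exprD mulrA.
Qed.

(** Steps down from the row index lead to a row [org i] or to an entry that vanishes at an edge. In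
    the row [org i], columns whose coordinates leave the grid of [i] vanish. *)
Lemma hankel_eq0 :
  (forall i y, (ca y < n i)%N -> (cb y < m i)%N -> S (org i) y = 0) -> S = 0.
Proof.
move=> S0; apply/matrixP => x z; rewrite mxE.
have [k] := ubnP (ca x + cb x); elim: k x z => // k IH x z lek.
have [x0|x0] := posnP (ca x); last first.
  have [w uw] := up1_pred x0.
  have [le|lt] := leqP (n (blk z)) (ca z).+1; first exact: hankel1_outl uw.
  have [u uu] := up1_ex lt; rewrite (hankel1_step uw uu) IH ?oppr0//.
  by move: uw => /and3P[/eqP e1 /eqP e2 /eqP e3]; lia.
have [y0|y0] := posnP (cb x); last first.
  have [w uw] := up2_pred y0.
  have [le|lt] := leqP (m (blk z)) (cb z).+1; first exact: hankel2_outl uw.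
  have [u uu] := up2_ex lt; rewrite (hankel2_step uw uu) IH ?oppr0//.
  by move: uw => /and3P[/eqP e1 /eqP e2 /eqP e3]; lia.
have [le|lt] := leqP (n (blk x)) (ca z); first by apply: hankel_vanish1; lia.
have [le'|lt'] := leqP (m (blk x)) (cb z); first by apply: hankel_vanish2; lia.
have -> : x = org (blk x) by apply: coord_inj; rewrite ?blk_org ?ca_org ?cb_org.
exact: S0.
Qed.

End Props.

Definition hankel_mx (c : 'I_p -> 'I_p -> nat -> nat -> F) : 'M[F]_K :=
  \matrix_(x, z) ((-1) ^+ (ca x + cb x) * c (blk x) (blk z) (ca x + ca z)%N (cb x + cb z)%N).

(** Inside the grids the two terms cancel because [c] sees only the sums of coordinates. At an edge
    the sum leaves the grid of one of the blocks, so the support condition kills the term that has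
    no partner. *)
Lemma hankel_mxP c :
  (forall i j a b, ~~ [&& a < n i, a < n j, b < m i & b < m j]%N -> c i j a b = 0) ->
  hankel (hankel_mx c).
Proof.
move=> c0; split; apply/matrixP => x z; rewrite mxE shift_mul_trE [RHS]mxE.
- pose D := c (blk x) (blk z) (ca x + ca z).+1 (cb x + cb z)%N.
  have -> : (shift_mx F up1 *m hankel_mx c) x z = - ((-1) ^+ (ca x + cb x) * D).
    have [le|lt] := leqP (n (blk x)) (ca x).+1.
      rewrite shift_mul0; last exact: up1_none.
      by rewrite /D c0 ?mulr0 ?oppr0//; apply/negP => /and4P[]; lia.
    have [y uy] := up1_ex lt; rewrite (shift_mulE _ _ _ uy) => [|y'];
      last exact: up1_inj.
    move: uy => /and3P[/eqP e1 /eqP e2 /eqP e3].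
    by rewrite mxE e2 e3 -e1 addSn exprS mulN1r mulNr.
  have -> : (shift_mx F up1 *m (hankel_mx c)^T) z x = (-1) ^+ (ca x + cb x) * D.
    have [le|lt] := leqP (n (blk z)) (ca z).+1.
      rewrite shift_mul0; last exact: up1_none.
      by rewrite /D c0 ?mulr0 ?oppr0//; apply/negP => /and4P[]; lia.
    have [y uy] := up1_ex lt; rewrite (shift_mulE _ _ _ uy) => [|y'];
      last exact: up1_inj.
    move: uy => /and3P[/eqP e1 /eqP e2 /eqP e3].
    by rewrite 2!mxE e2 e3 -e1 addnS.
  by rewrite addNr.
- pose D := c (blk x) (blk z) (ca x + ca z)%N (cb x + cb z).+1.
  have -> : (shift_mx F up2 *m hankel_mx c) x z = - ((-1) ^+ (ca x + cb x) * D).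
    have [le|lt] := leqP (m (blk x)) (cb x).+1.
      rewrite shift_mul0; last exact: up2_none.
      by rewrite /D c0 ?mulr0 ?oppr0//; apply/negP => /and4P[]; lia.
    have [y uy] := up2_ex lt; rewrite (shift_mulE _ _ _ uy) => [|y'];
      last exact: up2_inj.
    move: uy => /and3P[/eqP e1 /eqP e2 /eqP e3].
    by rewrite mxE e2 e3 -e1 addSn addnS exprS mulN1r mulNr.
  have -> : (shift_mx F up2 *m (hankel_mx c)^T) z x = (-1) ^+ (ca x + cb x) * D.
    have [le|lt] := leqP (m (blk z)) (cb z).+1.
      rewrite shift_mul0; last exact: up2_none.
      by rewrite /D c0 ?mulr0 ?oppr0//; apply/negP => /and4P[]; lia.
    have [y uy] := up2_ex lt; rewrite (shift_mulE _ _ _ uy) => [|y'];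
      last exact: up2_inj.
    move: uy => /and3P[/eqP e1 /eqP e2 /eqP e3].
    by rewrite 2!mxE e2 e3 -e1 addnS.
  by rewrite addNr.
Qed.

End Hankel.

(** * Dimensions of the solution spaces *)

Section HankelDim.
Variables (F : numFieldType) (p : nat) (n m : 'I_p -> nat).
Hypotheses (n_gt0 : forall i, (0 < n i)%N) (m_gt0 : forall i, (0 < m i)%N).
Local Notation K := (model_dim n m).
Local Notation org := (org n_gt0 m_gt0).

(** A pair [t] stands for the entry in row [org t.1] and column [t.2]. *)
Definition hankel_index : {pred 'I_p * 'I_K} :=
  [pred t : 'I_p * 'I_K | (ca t.2 < n t.1)%N && (cb t.2 < m t.1)%N].

Definition hankel_sym_index (e : bool) : {pred 'I_p * 'I_K} :=
  [pred t : 'I_p * 'I_K | [&& (t.1 < blk t.2)%N, (ca t.2 < n t.1)%N & (cb t.2 < m t.1)%N]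
         || (t.1 == blk t.2) && (odd (ca t.2 + cb t.2) == e)].

Lemma dim_hankel (V : {vspace 'M[F]_K}) (U T : 'M[F]_K) :
  U \in unitmx -> T \in unitmx ->
  (forall X, X \in V <-> hankel (U *m X *m T)) -> \dim V = #|hankel_index|.
Proof.
move=> uU uT VP.
apply: (dim_coord (f := fun X t => (U *m X *m T) (org t.1) t.2)) => [t a X Y|X|].
- by rewrite mulmxDr mulmxDl -scalemxAr -scalemxAl mxE [X in X + _]mxE.
- move=> /VP HX X0; have S0 := hankel_eq0 HX (n_gt0 := n_gt0) (m_gt0 := m_gt0).
  rewrite -[X](mulKmx uU) -[U *m X](mulmxK uT) S0 ?mul0mx ?mulmx0// => i y an bm.
  by apply: (X0 (i, y)); rewrite inE /= an.
move=> [i0 y0] /andP[/= an bm].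
pose c i j a b : F := [&& i == i0, j == blk y0, a == ca y0 & b == cb y0]%:R.
have UST S : U *m (invmx U *m S *m invmx T) *m T = S.
  by rewrite -mulmxA mulmxKV// mulKVmx.
exists (invmx U *m hankel_mx n m c *m invmx T) => [|[i y] _].
  apply/VP; rewrite UST; apply: hankel_mxP => i j a b nlt.
  rewrite /c; case: and4P => // -[/eqP ii /eqP jj /eqP aa /eqP bb].
  case/negP: nlt; rewrite ii jj aa bb an bm ca_lt cb_lt.
  by [].
rewrite UST mxE /= ca_org cb_org blk_org expr0 mul1r !add0n /c; congr (_%:R).
rewrite xpair_eqE; case: (i == i0) => //=; apply: congr1; apply/idP/idP.
  by move=> /and3P[/eqP e1 /eqP e2 /eqP e3]; apply/eqP/coord_inj.
by move=> /eqP->; rewrite !eqxx.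
Qed.

Lemma dim_hankel_sym (e : bool) (V : {vspace 'M[F]_K}) (U T : 'M[F]_K) :
  U \in unitmx -> T \in unitmx ->
  (forall X, X \in V <->
     hankel (U *m X *m T) /\ (U *m X *m T)^T = (-1) ^+ e *: (U *m X *m T)) ->
  \dim V = #|hankel_sym_index e|.
Proof.
move=> uU uT VP; have ee : (-1) ^+ e * (-1) ^+ e = 1 :> F by rewrite -expr2 sqrr_sign.
apply: (dim_coord (f := fun X t => (U *m X *m T) (org t.1) t.2)) => [t a X Y|X|].
- by rewrite mulmxDr mulmxDl -scalemxAr -scalemxAl mxE [X in X + _]mxE.
- move=> /VP[HX XT] X0; have S0 := hankel_eq0 HX (n_gt0 := n_gt0) (m_gt0 := m_gt0).
  rewrite -[X](mulKmx uU) -[U *m X](mulmxK uT) S0 ?mul0mx ?mulmx0// => i y an bm.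
  move: HX XT X0 {S0}; set S := U *m X *m T => HS ST S0.
  have Sx x z : S x z = (-1) ^+ e * S z x by rewrite -[S x z]/(S x z) -{1}[S]trmxK ST !mxE.
  case: (ltngtP i (blk y)) => [lt|gt|/val_inj eq].
  + by apply: (S0 (i, y)); rewrite inE /= lt an bm.
  + have [y' [b1 b2 b3]] := exists_pt an bm.
    rewrite Sx (hankel_swap n_gt0 m_gt0 HS b1 b2 b3).
    rewrite (S0 (blk y, y')) ?mulr0//.
    by rewrite inE /= b1 b2 b3 gt ca_lt cb_lt.
  + have [par|npar] := eqVneq (odd (ca y + cb y)) e.
      by apply: (S0 (i, y)); rewrite inE /= eq eqxx par eqxx orbT.
    have := hankel_swap n_gt0 m_gt0 HS (esym eq) (erefl (ca y)) (erefl (cb y)).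
    rewrite Sx -eq -[(-1) ^+ (ca y + cb y)]signr_odd => h.
    (* For the wrong parity, the sign of the swap and the sign of the symmetry differ, so the entry
       is its own negative. *)
    have {}h : S (org i) y = - S (org i) y.
      rewrite {1}[S (org i) y](_ : _ = (-1) ^+ e * ((-1) ^+ e * S (org i) y)); last first.
        by rewrite mulrA ee mul1r.
      rewrite h mulrA -signr_addb.
      by move: npar; case: (odd _) (e) => [] [] //= _; rewrite expr1 mulN1r.
    by apply/eqP; rewrite -[_ == 0](mulrn_eq0 _ 2) mulr2n {2}h subrr.
move=> [i0 y0] P0; pose j0 := blk y0.
have in0 : [&& (i0 <= j0)%N, (ca y0 < n i0)%N & (cb y0 < m i0)%N].
  by case/orP: P0 => /= [/and3P[/ltnW-> -> ->]//|/andP[/eqP-> _]]; rewrite leqnn ca_lt cb_lt.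
have par : i0 = j0 -> odd (ca y0 + cb y0) = e.
  by move=> ij; case/orP: P0 => /= [/and3P[]|/andP[_ /eqP]//]; rewrite -/j0 ij ltnn.
(* The first term realizes the coefficient at [(i0, y0)], the second its mirror image in the
   transposed pair of blocks. On a diagonal block the parity of [y0] already makes the first term
   symmetric, and a mirror image would double it. *)
pose c i j a b : F := (a == ca y0)%:R * (b == cb y0)%:R *
   (((i == i0) && (j == j0))%:R
    + (-1) ^+ e * (-1) ^+ (a + b) * [&& i0 != j0, i == j0 & j == i0]%:R).
have UST S : U *m (invmx U *m S *m invmx T) *m T = S.
  by rewrite -mulmxA mulmxKV// mulKVmx.
exists (invmx U *m hankel_mx n m c *m invmx T) => [|[i y] P1].
  apply/VP; rewrite UST; split.
    apply: hankel_mxP => i j a b nlt; rewrite /c.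
    case: eqP => [aa|]; rewrite ?mul0r//; case: eqP => [bb|]; rewrite ?mulr0 ?mul0r//.
    case/and3P: in0 => _ an bm.
    case: (boolP (_ && _)) => [/andP[/eqP ii /eqP jj]|_].
      by case/negP: nlt; rewrite ii jj aa bb an bm ca_lt cb_lt.
    case: (boolP [&& _, _ & _]) => [/and3P[_ /eqP ii /eqP jj]|_].
      by case/negP: nlt; rewrite ii jj aa bb an bm ca_lt cb_lt.
    by rewrite !mulr0 addr0 mulr0.
  apply/matrixP => x z; rewrite !mxE /c [(ca z + ca x)%N]addnC [(cb z + cb x)%N]addnC.
  case: (eqVneq (ca x + ca z)%N (ca y0)) => [aa|]; rewrite ?mul0r ?mulr0//.
  case: (eqVneq (cb x + cb z)%N (cb y0)) => [bb|]; rewrite ?mulr0 ?mul0r ?mulr0// !mul1r.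
  have -> : (-1) ^+ (ca z + cb z) = (-1) ^+ (ca x + cb x) * (-1) ^+ (ca y0 + cb y0) :> F.
    rewrite -exprD -aa -bb -signr_odd -[RHS]signr_odd; congr (_ ^+ nat_of_bool _).
    by rewrite !oddD; do 4 case: (odd _).
  rewrite aa bb -mulrA [RHS]mulrCA; congr (_ * _).
  have [ij|ij] := eqVneq i0 j0.
    have -> : (-1) ^+ (ca y0 + cb y0) = (-1) ^+ e :> F by rewrite -signr_odd par.
    by rewrite /= !mulr0 !addr0 ij andbC.
  have alg (s E P Q : F) : s * s = 1 -> E * E = 1 ->
      s * (P + E * s * Q) = E * (Q + E * s * P).
    move=> ss EE; transitivity (s * P + E * (s * s) * Q); first by ring.
    rewrite ss; transitivity (E * Q + (E * E) * s * P); last by ring.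
    by rewrite EE; ring.
  rewrite /= [(blk z == j0) && _]andbC [(blk x == j0) && _]andbC; apply: alg => //.
  by rewrite -expr2 -exprM muln2 -signr_odd odd_double.
rewrite UST mxE /= ca_org cb_org blk_org expr0 mul1r !add0n /c xpair_eqE.
(* The mirror image lies below the block diagonal, where the index set has no element. *)
have -> : [&& i0 != j0, i == j0 & blk y == i0] = false.
  apply/negP => /and3P[ij /eqP ii /eqP yy].
  move: in0 => /andP[le _]; have lt : (i0 < j0)%N by rewrite ltn_neqAle ij.
  case/orP: P1 => /= [/and3P[]|/andP[/eqP iy _]].
    by rewrite ii yy ltnNge le.
  by rewrite -ii iy yy ltnn in lt.
rewrite mulr0 addr0 -!natrM !mulnb; congr (nat_of_bool _)%:R.
rewrite andbC -andbA; case: (i == i0) => //=; apply/idP/idP.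
  by move=> /and3P[/eqP e1 /eqP e2 /eqP e3]; apply/eqP/coord_inj.
by move=> /eqP->; rewrite !eqxx.
Qed.

End HankelDim.

(** * Counting the index sets *)

(** The number of points of a grid of area [k] whose coordinate sum has parity [e]. Parities
    alternate as on a chessboard with an even corner, so only the area matters. *)
Definition half_par (e : bool) k := if e then k./2 else uphalf k.

Lemma sum_ltn A N : (\sum_(a < N) (a < A) = minn A N)%N.
Proof.
elim: N => [|N IH]; first by rewrite big_ord0 minn0.
by rewrite big_ord_recr /= IH; lia.
Qed.

Lemma sum_parity e a M : (\sum_(b < M) (odd (a + b) == e) = half_par (e (+) odd a) M)%N.
Proof.
elim: M => [|M IH]; first by rewrite big_ord0; case: (e (+) _).
rewrite big_ord_recr /= IH oddD; case: (e) (odd a) => [] [] /=; lia.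
Qed.

Lemma sum_parity2 e N M :
  (\sum_(a < N) \sum_(b < M) (odd (a + b) == e) = half_par e (N * M))%N.
Proof.
elim: N => [|N IH]; first by rewrite big_ord0 mul0n; case: e.
rewrite big_ord_recr /= IH sum_parity mulSn -{1 3}(odd_double_half N) mulnDl -doubleMl.
move: (N./2 * M)%N => Y; case: (e); case: (odd N) => /=; rewrite ?mul1n ?mul0n; lia.
Qed.

Section Count.
Variables (p : nat) (n m : 'I_p -> nat).

Lemma card_pair_sum (I J : finType) (P : {pred I * J}) :
  #|P| = (\sum_(i : I) \sum_(j : J) nat_of_bool ((i, j) \in P))%N.
Proof.
rewrite pair_big -sum1_card big_mkcond; apply: eq_bigr => -[i j] _ /=.
by case: (_ \in P).
Qed.

Lemma card_hankel_index :
  #|@hankel_index p n m| =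
  (\sum_i \sum_j minn (n i) (n j) * minn (m i) (m j))%N.
Proof.
rewrite card_pair_sum; apply: eq_bigr => i _.
pose G (j : 'I_p) a b := ((a < n i) * (b < m i))%N.
transitivity (\sum_(x < model_dim n m) G (blk x) (ca x) (cb x))%N.
  by apply: eq_bigr => x _; rewrite inE /G mulnb.
rewrite big_coord /G; apply: eq_bigr => j _.
by rewrite -big_distrlr /= !sum_ltn.
Qed.

Lemma card_hankel_sym_index e :
  #|@hankel_sym_index p n m e| =
  (\sum_i half_par e (n i * m i) +
   \sum_(i < p) \sum_(j < p | i < j) minn (n i) (n j) * minn (m i) (m j))%N.
Proof.
rewrite card_pair_sum addnC -big_split /=; apply: eq_bigr => i _.
pose G (j : 'I_p) a b := ((if (i < j)%N then (a < n i) * (b < m i) else 0) +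
   (if j == i then (odd (a + b) == e) : nat else 0))%N.
transitivity (\sum_(x < model_dim n m) G (blk x) (ca x) (cb x))%N.
  apply: eq_bigr => x _; rewrite inE /= /G [blk x == i]eq_sym.
  case: (ltngtP i (blk x)) => [lt|gt|/val_inj eq].
  - by rewrite -val_eqE /= ltn_eqF//= orbF addn0 mulnb.
  - by rewrite -val_eqE /= gtn_eqF.
  - by rewrite -eq eqxx.
rewrite big_coord /G.
under eq_bigr => j _ do under eq_bigr => a _ do rewrite big_split /=.
under eq_bigr => j _ do rewrite big_split /=.
rewrite big_split /= [in RHS]big_mkcond /=; congr (_ + _)%N.
  apply: eq_bigr => j _; case: ifP => _; last by rewrite !big1// => a _; rewrite big1.
  by rewrite -big_distrlr /= !sum_ltn.
rewrite (bigD1 i) //= eqxx sum_parity2 big1 ?addn0// => j ji.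
by rewrite big1// => a _; rewrite big1// (negPf ji).
Qed.

End Count.

(** * Comparison of the counts with the ranks *)

Lemma perm_eq_pairs (T : eqType) (u v u' v' : T) :
  perm_eq [:: u; v] [:: u'; v'] -> u = u' /\ v = v' \/ u = v' /\ v = u'.
Proof.
move=> e; have : u \in [:: u'; v'] by rewrite -(perm_mem e) mem_head.
have p1 (x y : T) : perm_eq [:: x] [:: y] -> x = y.
  by move=> /perm_mem/(_ x); rewrite !inE eqxx => /esym/eqP.
rewrite !inE => /orP[/eqP ?|/eqP ?]; subst u; [left|right]; split=> //; apply: p1.
  by rewrite perm_cons in e.
by move: e; rewrite (perm_sym _ [:: u'; v']) (perm_catC [:: u'] [:: v']) /= perm_cons perm_sym.
Qed.

Section Arithmetic.
Local Open Scope nat_scope.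
Variables (p : nat) (n m : 'I_p -> nat).
Hypotheses (n_gt0 : forall i, 0 < n i) (m_gt0 : forall i, 0 < m i).

Let off := \sum_(i < p) \sum_(j < p | i < j) minn (n i) (n j) * minn (m i) (m j).

Lemma min_mul_gt0 i j : 0 < minn (n i) (n j) * minn (m i) (m j).
Proof. by rewrite muln_gt0 !leq_min !n_gt0 !m_gt0. Qed.

(** Each pair made of the first block and another one contributes at least 1. *)
Lemma off_ge : p.-1 <= off.
Proof.
rewrite /off; case: p n m n_gt0 m_gt0 min_mul_gt0 => // q n' m' n0 m0 min0 /=.
rewrite big_ord_recl /= (leq_trans _ (leq_addr _ _))//.
rewrite big_mkcond big_ord_recl /= add0n.
rewrite -{1}[q]muln1 -{1}[q]card_ord -sum_nat_const; apply: leq_sum => j _.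
exact: min0.
Qed.

(** The terms with [i = j] already add up to the right-hand side, and all the others are
    positive. *)
Lemma sl_count : 0 < p ->
  \sum_(i < p) \sum_(j < p) minn (n i) (n j) * minn (m i) (m j) =
  \sum_(i < p) n i * m i <-> p = 1.
Proof.
move=> p0; have E : \sum_(i < p) \sum_(j < p) minn (n i) (n j) * minn (m i) (m j) =
    \sum_(i < p) n i * m i +
    \sum_(i < p) \sum_(j < p | j != i) minn (n i) (n j) * minn (m i) (m j).
  by rewrite -big_split; apply: eq_bigr => i _; rewrite (bigD1 i) //= !minnn.
have Egt : off <= \sum_(i < p) \sum_(j < p | j != i) minn (n i) (n j) * minn (m i) (m j).
  rewrite /off; apply: leq_sum => i _; rewrite big_mkcond [leqRHS]big_mkcond.
  apply: leq_sum => j _; case: ltnP => // lt.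
  by rewrite -val_eqE /= gtn_eqF.
split=> [|p1]; first by have := off_ge; rewrite E; lia.
rewrite E; apply/eqP; rewrite -[X in _ == X]addn0 eqn_add2l; apply/eqP.
rewrite big1// => i _; rewrite big1// => j.
by rewrite -val_eqE /=; have := ltn_ord i; have := ltn_ord j; lia.
Qed.

Lemma sum_uphalf_ge : \sum_(i < p) n i * m i <= (\sum_(i < p) uphalf (n i * m i)).*2.
Proof.
elim/big_ind2: _ => // [a b c d|i _]; first by rewrite doubleD; exact: leq_add.
by move: (n i * m i) => k; lia.
Qed.

Lemma sum_half_le :
  \sum_(i < p) n i * m i <= (\sum_(i < p) (n i * m i)./2).*2 + p.
Proof.
have e : \sum_(i < p) 1 = p by rewrite sum1_card card_ord.
rewrite -[X in _ + X]e -mul2n big_distrr -big_split /=.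
by apply: leq_sum => i _; move: (n i * m i) => k; lia.
Qed.

(** Rounding up makes the diagonal blocks alone reach the rank, so [off] must be 0. *)
Lemma sp_count :
  \sum_(i < p) uphalf (n i * m i) + off = (\sum_(i < p) n i * m i)./2 -> p <= 1.
Proof. by have := off_ge; have := sum_uphalf_ge; lia. Qed.

(** Rounding down loses at most 1/2 per block, so p - 1 is at most p / 2. *)
Lemma so_count_le :
  \sum_(i < p) (n i * m i)./2 + off = (\sum_(i < p) n i * m i)./2 -> p <= 2.
Proof. by have := off_ge; have := sum_half_le; lia. Qed.

Lemma size_Jset : size (Jset n m) = p.
Proof. by rewrite size_map size_enum_ord. Qed.

End Arithmetic.

(** Two halves rounded down fall short of the rounded half of the sum by 1 if both numbers are odd
    and by 0 otherwise, while the product of minima is at least 1. *)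
Lemma so_count2 (x y z w : nat) :
  (0 < x -> 0 < y -> 0 < z -> 0 < w ->
  (x * y)./2 + (z * w)./2 + minn x z * minn y w = (x * y + z * w)./2 <->
  [/\ odd (x * y), odd (z * w), minn x z = 1 & minn y w = 1])%N.
Proof.
move=> x0 y0 z0 w0; have mm : (0 < minn x z * minn y w)%N.
  by rewrite muln_gt0 !leq_min x0 y0 z0 w0.
split=> [|[oxy ozw -> ->]]; last by move: (x * y)%N (z * w)%N oxy ozw => a b; lia.
move=> e; have /and3P[oa ob /eqP]: [&& odd (x * y), odd (z * w) & minn x z * minn y w == 1]%N.
  by move: (x * y)%N (z * w)%N (minn x z * minn y w)%N mm e => a b c; lia.
by move/eqP; rewrite muln_eq1 => /andP[/eqP-> /eqP->].
Qed.

Lemma so_count (p : nat) (n m : 'I_p -> nat) :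
  (forall i, 0 < n i)%N -> (forall i, 0 < m i)%N -> (0 < p)%N ->
  (\sum_(i < p) (n i * m i)./2 +
    \sum_(i < p) \sum_(j < p | i < j) minn (n i) (n j) * minn (m i) (m j)
    = (\sum_(i < p) n i * m i)./2)%N <->
  p = 1%N \/ exists a b, odd a /\ odd b /\
    (perm_eq (Jset n m) [:: (a, b); (1%N, 1%N)] \/
     perm_eq (Jset n m) [:: (a, 1%N); (1%N, b)]).
Proof.
move=> n0 m0 p0; have [p3|p2] := ltnP 2 p.
  split=> [/(so_count_le n0 m0)|]; first by rewrite leqNgt p3.
  case=> [p1|[a [b [_ [_ J]]]]]; first by rewrite p1 in p3.
  have := size_Jset n m; case: J => /perm_size -> p2.
    by rewrite -p2 in p3.
  by rewrite -p2 in p3.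
case: p n m n0 m0 p0 p2 => [|[|[|p]]] n m n0 m0 // _ _.
  split=> [_|_]; first by left.
  rewrite !big_ord1 [X in (_ + X)%N]big1 ?addn0// => j.
  by rewrite [j]ord1.
have JE : Jset n m = [:: (n ord0, m ord0); (n (lift ord0 ord0), m (lift ord0 ord0))].
  by rewrite /Jset !enum_ordSl /= enum_ord0.
have -> : (\sum_(i < 2) \sum_(j < 2 | i < j) minn (n i) (n j) * minn (m i) (m j) =
    minn (n ord0) (n (lift ord0 ord0)) * minn (m ord0) (m (lift ord0 ord0)))%N.
  rewrite big_ord_recl big_ord1 [X in (_ + X)%N]big1 => [|j]; last first.
    by case: j => [[|[|j]]].
  by rewrite addn0 big_mkcond big_ord_recl big_ord1 /= add0n.
rewrite JE !big_ord_recl !big_ord0 !addn0.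
have := so_count2 (n0 ord0) (m0 ord0) (n0 (lift ord0 ord0)) (m0 (lift ord0 ord0)).
move: (n ord0) (m ord0) (n (lift ord0 ord0)) (m (lift ord0 ord0)) => x y z w cnt.
split=> [/cnt[]|[//|[a [b [oa [ob J]]]]]].
  rewrite !oddM => /andP[ox oy] /andP[oz ow] xz yw; right.
  have {}xz : x = 1%N \/ z = 1%N by lia.
  have {}yw : y = 1%N \/ w = 1%N by lia.
  (* Whether the two coordinates equal to 1 belong to the same block or to different ones decides
     between the two shapes, up to order. *)
  case: xz yw => ? [] ?; subst.
  - by exists z, w; do 2 split=> //; left; rewrite (perm_catC [:: _] [:: _]).
  - by exists z, y; do 2 split=> //; right; rewrite (perm_catC [:: _] [:: _]).
  - by exists x, w; do 2 split=> //; right.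
  - by exists x, y; do 2 split=> //; left.
have a0 : (0 < a)%N by exact: odd_gt0.
have b0 : (0 < b)%N by exact: odd_gt0.
apply/cnt; case: J => /perm_eq_pairs [] [[-> ->] [-> ->]];
  by rewrite ?oddM ?oa ?ob; split=> //; lia.
Qed.

Lemma one_block (p : nat) (n m : 'I_p -> nat) : p = 1%N ->
  exists i, [/\ Jset n m = [:: (n i, m i)],
    forall f : nat -> nat, (\sum_(i < p) f (n i * m i) = f (n i * m i))%N &
    (\sum_(i < p) \sum_(j < p | i < j) minn (n i) (n j) * minn (m i) (m j) = 0)%N].
Proof.
move=> p1; subst p; exists ord0; split.
- by rewrite /Jset enum_ordSl enum_ord0.
- by move=> f; rewrite big_ord1.
- by rewrite big_ord1 big1// => j; rewrite [j]ord1.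
Qed.

(** * From centralizers to Hankel matrices *)

Lemma mulmx_unit_eq0 (F : comUnitRingType) N (A Z B : 'M[F]_N) :
  A \in unitmx -> B \in unitmx -> (A *m Z *m B == 0) = (Z == 0).
Proof.
move=> uA uB; apply/eqP/eqP => [AZB|->]; last by rewrite mulmx0 mul0mx.
by rewrite -[Z](mulKmx uA) -[A *m Z](mulmxK uB) AZB mul0mx mulmx0.
Qed.

Lemma conj_invmx (F : comUnitRingType) N (U E J : 'M[F]_N) : U \in unitmx ->
  E *m U = U *m J -> J *m invmx U = invmx U *m E.
Proof.
move=> uU EU; apply: (can_inj (mulKmx uU)); apply: (can_inj (mulmxK uU)).
by rewrite /= !mulmxA mulmxKV// mulmxV// mul1mx.
Qed.

(** [T] intertwines [E] with minus the transposed shift, so the commutator of [X] and [E] becomes a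
    sum after multiplication by [T] on the right. *)
Lemma commutes_conj (F : comUnitRingType) N (U T E J X : 'M[F]_N) :
  U \in unitmx -> T \in unitmx -> E *m U = U *m J -> T *m J^T = - (E *m T) ->
  (X *m E == E *m X) =
  (J *m (invmx U *m X *m T) + (invmx U *m X *m T) *m J^T == 0).
Proof.
move=> uU uT EU ET; rewrite -[_ *m J^T]mulmxA ET mulmxN !mulmxA (conj_invmx uU EU).
rewrite -!(mulmxA (invmx U)) -mulmxBr -mulmxBl mulmxA mulmx_unit_eq0 ?unitmx_inv//.
by rewrite subr_eq0 eq_sym.
Qed.

Section HankelUnits.
Variables (F : numFieldType) (p : nat) (n m : 'I_p -> nat).
Hypotheses (n_gt0 : forall i, (0 < n i)%N) (m_gt0 : forall i, (0 < m i)%N).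
Local Notation K := (model_dim n m).

(** This stands in for the inverse form when there is no form: on each block it pairs a point with
    its reflection through the centre of the grid, up to sign. *)
Lemma exists_hankel_unit : exists2 D : 'M[F]_K, D \in unitmx & hankel D.
Proof.
pose c i j a b : F := [&& i == j, a == (n i).-1 & b == (m i).-1]%:R.
have /fin_all_exists[r rP] : forall x : 'I_K, exists y : 'I_K,
    [/\ blk y = blk x, ca y = ((n (blk x)).-1 - ca x)%N & cb y = ((m (blk x)).-1 - cb x)%N].
  by move=> x; apply: exists_pt; [have := ca_lt x | have := cb_lt x]; lia.
have rE x z : [&& blk x == blk z, (ca x + ca z == (n (blk x)).-1)%N &
    (cb x + cb z == (m (blk x)).-1)%N] = (z == r x).
  have [r1 r2 r3] := rP x; have := ca_lt x; have := cb_lt x => lb la.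
  apply/idP/eqP => [/and3P[/eqP e1 /eqP e2 /eqP e3]|->].
    by apply: coord_inj; rewrite ?r1 ?r2 ?r3//; lia.
  by rewrite r1 r2 r3 eqxx; apply/andP; split; apply/eqP; lia.
have rI : injective r.
  move=> x y e; have [r1 r2 r3] := rP x; have [s1 s2 s3] := rP y.
  have exy : blk x = blk y by rewrite -r1 -s1 e.
  apply: coord_inj => //.
    have := ca_lt x; have := ca_lt y; rewrite -exy => l1 l2.
    by move: r2 s2; rewrite e exy => ->; rewrite -exy; lia.
  have := cb_lt x; have := cb_lt y; rewrite -exy => l1 l2.
  by move: r3 s3; rewrite e exy => ->; rewrite -exy; lia.
exists (hankel_mx n m c); last first.
  apply: hankel_mxP => i j a b nlt; rewrite /c; case: and3P => // -[/eqP ij /eqP aa /eqP bb].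
  case/negP: nlt; rewrite -ij aa bb; have := n_gt0 i; have := m_gt0 i.
  by case: (n i) (m i) => [|?] [|?] //= _ _; rewrite !ltnSn.
suff : hankel_mx n m c *m (hankel_mx n m c)^T = 1%:M by case/mulmx1_unit.
apply/matrixP => x y; rewrite mxE (bigD1 (r x)) //= big1 => [|z zx]; last first.
  by rewrite mxE /c rE (negPf zx) mulr0 mul0r.
rewrite addr0 !mxE /c !rE eqxx (inj_eq rI) mulr1.
have [->|_] := eqVneq x y; last by rewrite !mulr0.
by rewrite mulr1 -expr2 sqrr_sign.
Qed.

End HankelUnits.

(* The last column of [S] has a single nonzero entry, at the origin, where
   antitransposition and symmetry must agree. *)
Lemma hankel_unit_parity (F : numFieldType) (n m : 'I_1 -> nat) (e : bool)
    (S : 'M[F]_(model_dim n m)) :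
  (0 < n ord0)%N -> (0 < m ord0)%N ->
  hankel S -> S^T = (-1) ^+ e *: S -> S \in unitmx -> odd (n ord0 + m ord0) = e.
Proof.
move=> n0 m0 HS ST uS.
have N0 i : (0 < n i)%N by rewrite ord1.
have M0 i : (0 < m i)%N by rewrite ord1.
have an : ((n ord0).-1 < n ord0)%N by rewrite ltn_predL.
have bm : ((m ord0).-1 < m ord0)%N by rewrite ltn_predL.
have [t [t1 t2 t3]] := exists_pt an bm.
pose o := org N0 M0 ord0.
have St x : x != o -> S x t = 0.
  move=> xo; have [ax|ax] := posnP (ca x); last first.
    by apply: (hankel_vanish1 HS); rewrite t2 (_ : n (blk x) = n ord0); [lia | rewrite [blk x]ord1].
  have [bx|bx] := posnP (cb x); last first.
    by apply: (hankel_vanish2 HS); rewrite t3 (_ : m (blk x) = m ord0); [lia | rewrite [blk x]ord1].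
  case/eqP: xo; apply: coord_inj; rewrite ?ca_org ?cb_org//.
  by rewrite !ord1.
have Sot : S o t != 0.
  apply/negP => /eqP So; have : col t S = 0.
    by apply/colP => x; rewrite !mxE; have [->|/St] := eqVneq x o.
  move=> c0; have : col t (invmx S *m S) = 0.
    by rewrite colE -mulmxA -colE c0 mulmx0.
  rewrite mulVmx// => /colP/(_ t); rewrite !mxE eqxx => /eqP.
  by rewrite oner_eq0.
have := hankel_swap N0 M0 HS t1 (erefl (ca t)) (erefl (cb t)).
rewrite t1 t2 t3 -/o.
have -> : S t o = (-1) ^+ e * S o t.
  by rewrite -[S t o](mxE tt (fun i j => S j i)); have /matrixP/(_ o t) := ST; rewrite !mxE.
move=> /(mulIf Sot); rewrite -[(-1) ^+ (_ + _)]signr_odd => /signr_inj.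
(* The corner [t] has coordinates n - 1 and m - 1, whose sum has the parity of n + m. *)
by move: n0 m0; case: (n ord0) (m ord0) => [|a] [|b] //= _ _ ->; rewrite addnS /= negbK.
Qed.

Section Pair.
Variables (R : realType) (p : nat) (n m : 'I_p -> nat).
Hypotheses (n_gt0 : forall i, (0 < n i)%N) (m_gt0 : forall i, (0 < m i)%N).
Local Notation C := (R[i]).
Local Notation K := (model_dim n m).

Lemma cent_gl_pairE (E1 E2 X : 'M[C]_K) :
  (X \in (cent_gl E1 :&: cent_gl E2)%VS) =
  (X *m E1 == E1 *m X) && (X *m E2 == E2 *m X).
Proof. by rewrite memv_cap; congr (_ && _); exact: cent_glE. Qed.

Section Cent.
Variables (U T E1 E2 : 'M[C]_K).
Hypotheses (uU : U \in unitmx) (uT : T \in unitmx).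
Hypotheses (EU1 : E1 *m U = U *m shift_mx C (@up1 p n m))
  (EU2 : E2 *m U = U *m shift_mx C (@up2 p n m))
  (ET1 : T *m (shift_mx C (@up1 p n m))^T = - (E1 *m T))
  (ET2 : T *m (shift_mx C (@up2 p n m))^T = - (E2 *m T)).

Lemma hankel_cent X :
  X \in (cent_gl E1 :&: cent_gl E2)%VS <-> hankel (invmx U *m X *m T).
Proof.
rewrite cent_gl_pairE.
rewrite (commutes_conj X uU uT EU1 ET1) (commutes_conj X uU uT EU2 ET2).
split=> [/andP[/eqP h1 /eqP h2]|[/eqP h1 /eqP h2]]; first exact: conj h1 h2.
exact/andP/(conj h1 h2).
Qed.
End Cent.

Section Transport.
Variables (U E1 E2 : 'M[C]_K).
Hypothesis uU : U \in unitmx.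
Hypotheses (EU1 : E1 *m U = U *m shift_mx C (@up1 p n m))
  (EU2 : E2 *m U = U *m shift_mx C (@up2 p n m)).

Lemma dim_cent_gl_pair :
  \dim (cent_gl E1 :&: cent_gl E2)%VS = #|@hankel_index p n m|.
Proof.
have [D uD [D1 D2]] := exists_hankel_unit C n_gt0 m_gt0.
have uUi : invmx U \in unitmx by rewrite unitmx_inv.
have uUD : U *m D \in unitmx by rewrite unitmx_mul uU.
apply: (dim_hankel n_gt0 m_gt0 uUi uUD) => X; apply: hankel_cent => //.
  by rewrite mulmxA EU1 -!mulmxA -mulmxN; congr (_ *m _); apply/eqP; rewrite -addr_eq0 addrC D1.
by rewrite mulmxA EU2 -!mulmxA -mulmxN; congr (_ *m _); apply/eqP; rewrite -addr_eq0 addrC D2.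
Qed.

Section Form.
Variables (B : 'M[C]_K) (e : bool).
Hypotheses (uB : B \in unitmx) (Bsym : B^T = (-1) ^+ e *: B).
Hypotheses (E1B : E1 \in gl_form B) (E2B : E2 \in gl_form B).
(** With this choice [invmx U *m X *m T] is the matrix [X *m invmx B], viewed as a bilinear form on
    the dual space, in the basis that turns [E1] and [E2] into shifts. *)
Let T := invmx B *m (invmx U)^T.

Let uT : T \in unitmx.
Proof. by rewrite unitmx_mul unitmx_inv uB unitmx_tr unitmx_inv. Qed.

Lemma form_shift (E J : 'M[C]_K) : E \in gl_form B -> E *m U = U *m J ->
  T *m J^T = - (E *m T).
Proof.
rewrite gl_formE addr_eq0 => /eqP EB EU.
have UJ := conj_invmx uU EU.
rewrite /T -mulmxA -trmx_mul UJ trmx_mul !mulmxA -mulNmx; congr (_ *m _).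
apply: (can_inj (mulKmx uB)); apply: (can_inj (mulmxK uB)).
by rewrite /= mulmxN mulNmx !mulmxA mulmxV// mul1mx EB mulmxKV.
Qed.

Lemma form_inv_sym : (invmx B)^T = (-1) ^+ e *: invmx B.
Proof.
have ee : (-1) ^+ e * (-1) ^+ e = 1 :> C by rewrite -expr2 sqrr_sign.
rewrite trmx_inv Bsym; apply: (can_inj (mulKmx (_ : (-1) ^+ e *: B \in unitmx))).
  by rewrite -Bsym unitmx_tr.
rewrite /= mulmxV -?Bsym ?unitmx_tr// Bsym -scalemxAl -scalemxAr scalerA ee scale1r.
by rewrite mulmxV.
Qed.

Lemma form_mx_sym X : (invmx U *m X *m T)^T =
   (-1) ^+ e *: (invmx U *m (invmx B *m X^T) *m (invmx U)^T).
Proof.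
by rewrite /T !trmx_mul trmxK form_inv_sym -!scalemxAr -!scalemxAl !mulmxA.
Qed.

(** [X] is skew for [B] exactly when [X *m invmx B] has the symmetry opposite to that of [B]; hence
    the negation of [e]. *)
Lemma dim_cent_form_pair :
  \dim (gl_form B :&: cent_gl E1 :&: cent_gl E2)%VS = #|@hankel_sym_index p n m (~~ e)|.
Proof.
have uUi : invmx U \in unitmx by rewrite unitmx_inv.
have ee : (-1) ^+ (~~ e) = - (-1) ^+ e :> C by case: (e); rewrite ?expr1 ?expr0 ?opprK.
apply: (dim_hankel_sym n_gt0 m_gt0 (e := ~~ e) uUi uT) => X.
rewrite -capvA memv_cap form_mx_sym ee scaleNr.
have symP : (X \in gl_form B) = ((-1) ^+ e *: (invmx U *m (invmx B *m X^T) *m (invmx U)^T)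
    == - ((-1) ^+ e *: (invmx U *m X *m T))).
  have uUT : (invmx U)^T \in unitmx by rewrite unitmx_tr.
  rewrite -addr_eq0 -scalerDr scaler_eq0 signr_eq0 /= /T [invmx U *m X *m _]mulmxA.
  rewrite -[invmx U *m X *m invmx B]mulmxA -mulmxDl -mulmxDr mulmx_unit_eq0//.
  rewrite gl_formE -(mulmx_unit_eq0 _ uB uB) mulmxDr mulmxDl !mulmxA mulmxV//.
  by rewrite mul1mx mulmxKV.
have HC := hankel_cent uU uT EU1 EU2 (form_shift E1B EU1) (form_shift E2B EU2) X.
by rewrite symP; split=> [/andP[/eqP XB /HC]|[/HC -> /eqP ->]].
Qed.

(** The identity commutes with everything, and its image is the inverse form itself. Its symmetry is
    that of [B], and this feeds the parity obstruction on a single block. *)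
Lemma form_hankel_unit :
  exists S : 'M[C]_K, [/\ hankel S, S^T = (-1) ^+ e *: S & S \in unitmx].
Proof.
exists (invmx U *m 1%:M *m T); split.
- apply/(hankel_cent uU uT EU1 EU2 (form_shift E1B EU1) (form_shift E2B EU2)).
  by rewrite cent_gl_pairE !mul1mx !mulmx1 !eqxx.
- by rewrite form_mx_sym trmx1 !mulmx1 mulmxA.
- by rewrite mulmx1 unitmx_mul unitmx_inv uU uT.
Qed.

End Form.
End Transport.
End Pair.

(** * The torus *)

Lemma conj_scale (F : comUnitRingType) N (P D E M : 'M[F]_N) t :
  P \in unitmx -> D \in unitmx -> E *m P = P *m M -> D *m M = t *: (M *m D) ->
  (P *m D *m invmx P) *m E *m invmx (P *m D *m invmx P) = t *: E.
Proof.
move=> uP uD EP DM; set a := P *m D *m invmx P.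
have ua : a \in unitmx by rewrite !unitmx_mul unitmx_inv uP uD.
suff -> : a *m E = t *: (E *m a) by rewrite -scalemxAl mulmxK.
rewrite /a -mulmxA -(conj_invmx uP EP) !mulmxA EP -(mulmxA P D M) DM.
by rewrite -scalemxAr -scalemxAl !mulmxA.
Qed.

Lemma conj_isometry (F : comUnitRingType) N (P D B : 'M[F]_N) :
  P \in unitmx -> D^T = D -> D *m (P^T *m B *m P) *m D = P^T *m B *m P ->
  (P *m D *m invmx P)^T *m B *m (P *m D *m invmx P) = B.
Proof.
move=> uP DT DG; have uPT : P^T \in unitmx by rewrite unitmx_tr.
apply: (can_inj (mulKmx uPT)); apply: (can_inj (mulmxK uP)).
rewrite /= -[RHS]DG !trmx_mul DT !mulmxA.
by rewrite -[P^T *m _]trmx_mul mulVmx// trmx1 mul1mx mulmxKV.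
Qed.

Lemma form_pullback (F : comNzRingType) N (P B H D : 'M[F]_N) :
  H *m P = P *m D -> D^T = D -> H^T *m B + B *m H = 0 ->
  D *m (P^T *m B *m P) + (P^T *m B *m P) *m D = 0.
Proof.
move=> HP DT HB; have := congr1 (fun X => P^T *m X *m P) HB.
rewrite /= mulmx0 mul0mx mulmxDr mulmxDl => <-; congr (_ + _).
  by rewrite !mulmxA -trmx_mul HP trmx_mul DT.
by rewrite -!mulmxA HP.
Qed.

Lemma prod_exprz (F : fieldType) (I : finType) (s : F) (w : I -> int) :
  s != 0 -> \prod_i s ^ w i = s ^ (\sum_i w i).
Proof.
by move=> s0; elim/big_rec2: _ => // i a b _ ->; rewrite expfzDr.
Qed.

Lemma exprz_cancel (F : fieldType) (s t : F) (i j k l : int) :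
  s != 0 -> t != 0 -> i + k = 0 -> j + l = 0 ->
  (s ^ i * t ^ j) * (s ^ k * t ^ l) = 1.
Proof.
by move=> s0 t0 ik jl; rewrite mulrACA -!expfzDr// ik jl !expr0z mulr1.
Qed.

Section Weights.
Variables (R : realType) (p : nat) (n m : 'I_p -> nat).
Local Notation C := (R[i]).
Local Notation K := (model_dim n m).

(** The eigenvalue of [sl2H], kept as an integer so that it can serve as an exponent. *)
Definition wt1 (x : 'I_K) : int := (n (blk x)).-1%:Z - (2 * ca x)%N%:Z.
Definition wt2 (x : 'I_K) : int := (m (blk x)).-1%:Z - (2 * cb x)%N%:Z.

Lemma model1_sl2H : model1 n m (sl2H R) = diag_mx (\row_x (wt1 x)%:~R).
Proof.
apply/matrixP => x y.
rewrite (model1E (f := fun k i j : nat =>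
  if i == j then (k.-1)%:R - (2 * j)%:R else 0)); last by move=> k i j; rewrite mxE.
rewrite !mxE; have [->|xy] := eqVneq x y.
  by rewrite !eqxx /= mulr1n /wt1 intrB -!pmulrn.
case: (eqVneq (blk x)) => //= e1; case: (eqVneq (cb x)) => //= e2.
by case: (eqVneq (ca x)) => // e3; case/eqP: xy; apply: coord_inj.
Qed.

Lemma model2_sl2H : model2 n m (sl2H R) = diag_mx (\row_x (wt2 x)%:~R).
Proof.
apply/matrixP => x y.
rewrite (model2E (f := fun k i j : nat =>
  if i == j then (k.-1)%:R - (2 * j)%:R else 0)); last by move=> k i j; rewrite mxE.
rewrite !mxE; have [->|xy] := eqVneq x y.
  by rewrite !eqxx /= mulr1n /wt2 intrB -!pmulrn.
case: (eqVneq (blk x)) => //= e1; case: (eqVneq (ca x)) => //= e2.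
by case: (eqVneq (cb x)) => // e3; case/eqP: xy; apply: coord_inj.
Qed.

Section Torus.
Variables s1 s2 : C.
Hypotheses (s10 : s1 != 0) (s20 : s2 != 0).

Definition torus : 'rV[C]_K := \row_x (s1 ^ wt1 x * s2 ^ wt2 x).

Lemma torus_unit : diag_mx torus \in unitmx.
Proof.
rewrite unitmxE det_diag unitfE; apply/prodf_neq0 => x _.
by rewrite mxE mulf_neq0// expfz_neq0.
Qed.

Lemma torus_sl2E1 :
  diag_mx torus *m model1 n m (sl2E R) =
  s1 ^+ 2 *: (model1 n m (sl2E R) *m diag_mx torus).
Proof.
apply/matrixP => x y; rewrite mul_mx_diag mul_diag_mx [LHS]mxE [RHS]mxE [X in _ = _ * X]mxE.
rewrite (model1E (f := fun k i j : nat => if j == i.+1 then (j * (k - j))%:R else 0)); last first.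
  by move=> k i j; rewrite mxE.
case: (eqVneq (blk x)) => /= [e1|_]; last by rewrite !(mulr0, mul0r).
case: (eqVneq (cb x)) => /= [e2|_]; last by rewrite !(mulr0, mul0r).
case: (eqVneq (ca y)) => /= [e3|_]; last by rewrite !(mulr0, mul0r).
have -> : torus 0 x = s1 ^+ 2 * torus 0 y.
  rewrite !mxE mulrA; congr (_ * s2 ^ _); last by rewrite /wt2 e1 e2.
  rewrite -[s1 ^+ 2]/(s1 ^ 2%:Z) -expfzDr//; congr (_ ^ _).
  by rewrite /wt1 e1 e3; lia.
by rewrite -mulrA [torus 0 y * _]mulrC.
Qed.

Lemma torus_sl2E2 :
  diag_mx torus *m model2 n m (sl2E R) =
  s2 ^+ 2 *: (model2 n m (sl2E R) *m diag_mx torus).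
Proof.
apply/matrixP => x y; rewrite mul_mx_diag mul_diag_mx [LHS]mxE [RHS]mxE [X in _ = _ * X]mxE.
rewrite (model2E (f := fun k i j : nat => if j == i.+1 then (j * (k - j))%:R else 0)); last first.
  by move=> k i j; rewrite mxE.
case: (eqVneq (blk x)) => /= [e1|_]; last by rewrite !(mulr0, mul0r).
case: (eqVneq (ca x)) => /= [e2|_]; last by rewrite !(mulr0, mul0r).
case: (eqVneq (cb y)) => /= [e3|_]; last by rewrite !(mulr0, mul0r).
have -> : torus 0 x = s2 ^+ 2 * torus 0 y.
  rewrite !mxE mulrCA; congr (s1 ^ _ * _); first by rewrite /wt1 e1 e2.
  rewrite -[s2 ^+ 2]/(s2 ^ 2%:Z) -expfzDr//; congr (_ ^ _).
  by rewrite /wt2 e1 e3; lia.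
by rewrite -mulrA [torus 0 y * _]mulrC.
Qed.

(** An invariant form pairs only opposite weights, so the two torus factors around an entry
    cancel. *)
Lemma weight_form (w : 'I_K -> int) (G : 'M[C]_K) :
  diag_mx (\row_x (w x)%:~R) *m G + G *m diag_mx (\row_x (w x)%:~R) = 0 ->
  forall x y, G x y != 0 -> w x + w y = 0.
Proof.
move=> /matrixP DG x y Gxy; have := DG x y.
rewrite mul_diag_mx mul_mx_diag !mxE [G x y * _]mulrC -mulrDl -intrD => /eqP.
by rewrite mulf_eq0 (negPf Gxy) orbF intr_eq0 => /eqP.
Qed.

Lemma torus_form (G : 'M[C]_K) :
  diag_mx (\row_x (wt1 x)%:~R) *m G + G *m diag_mx (\row_x (wt1 x)%:~R) = 0 ->
  diag_mx (\row_x (wt2 x)%:~R) *m G + G *m diag_mx (\row_x (wt2 x)%:~R) = 0 ->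
  diag_mx torus *m G *m diag_mx torus = G.
Proof.
move=> /weight_form G1 /weight_form G2; apply/matrixP => x y.
rewrite mul_mx_diag mul_diag_mx !mxE.
have [->|Gxy] := eqVneq (G x y) 0; first by rewrite mulr0 mul0r.
rewrite mulrAC (exprz_cancel s10 s20 (G1 _ _ Gxy) (G2 _ _ Gxy)).
exact: mul1r.
Qed.

Lemma det_torus : \tr (model1 n m (sl2H R)) = 0 -> \tr (model2 n m (sl2H R)) = 0 ->
  \det (diag_mx torus) = 1.
Proof.
rewrite model1_sl2H model2_sl2H !mxtrace_diag.
have sumE (w : 'I_K -> int) : \sum_x (\row_x (w x)%:~R : 'rV[C]_K) 0 x = 0 ->
    \sum_x w x = 0.
  under eq_bigr do rewrite mxE.
  by rewrite -(rmorph_sum (intmul 1)) /= => /eqP; rewrite intr_eq0 => /eqP.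
move=> /sumE h1 /sumE h2; rewrite det_diag.
under eq_bigr do rewrite mxE.
by rewrite big_split /= !prod_exprz// h1 h2 !expr0z mulr1.
Qed.

End Torus.

Lemma exists_torus_elt (P E1 H1 E2 H2 : 'M[C]_K) : P \in unitmx ->
  E1 *m P = P *m model1 n m (sl2E R) -> H1 *m P = P *m model1 n m (sl2H R) ->
  E2 *m P = P *m model2 n m (sl2E R) -> H2 *m P = P *m model2 n m (sl2H R) ->
  \tr H1 = 0 -> \tr H2 = 0 ->
  forall t1 t2 : C, t1 != 0 -> t2 != 0 ->
  exists a : 'M[C]_K, [/\ \det a = 1, a \in unitmx,
    forall B, H1 \in gl_form B -> H2 \in gl_form B -> a^T *m B *m a = B,
    a *m E1 *m invmx a = t1 *: E1 & a *m E2 *m invmx a = t2 *: E2].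
Proof.
move=> uP iE1 iH1 iE2 iH2 trH1 trH2 t1 t2 t10 t20.
(* [E1] and [E2] have weight 2, so the torus scales them by the squares of its parameters. *)
pose s1 := sqrtC t1; pose s2 := sqrtC t2.
have s10 : s1 != 0 by rewrite sqrtC_eq0.
have s20 : s2 != 0 by rewrite sqrtC_eq0.
have trP (H M : 'M[C]_K) : H *m P = P *m M -> \tr H = 0 -> \tr M = 0.
  move=> HP <-; rewrite -[H](mulmxK uP) HP mxtrace_mulC mulmxA.
  by rewrite mulVmx// mul1mx.
pose D := diag_mx (torus s1 s2); have uD : D \in unitmx := torus_unit s10 s20.
have dD : \det D = 1 := det_torus s10 s20 (trP _ _ iH1 trH1) (trP _ _ iH2 trH2).
exists (P *m D *m invmx P); split.
- by rewrite !det_mulmx dD mulr1 -det_mulmx mulmxV// det1.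
- by rewrite !unitmx_mul unitmx_inv uP uD.
- move=> B; rewrite !gl_formE => /eqP H1B /eqP H2B.
  have H1D : H1 *m P = P *m diag_mx (\row_x (wt1 x)%:~R) by rewrite iH1 model1_sl2H.
  have H2D : H2 *m P = P *m diag_mx (\row_x (wt2 x)%:~R) by rewrite iH2 model2_sl2H.
  apply: (conj_isometry uP (tr_diag_mx _)); apply: (torus_form s10 s20).
    exact: form_pullback H1D (tr_diag_mx _) H1B.
  exact: form_pullback H2D (tr_diag_mx _) H2B.
- by apply: (conj_scale uP uD iE1); rewrite (torus_sl2E1 s10 s20) sqrtCK.
- by apply: (conj_scale uP uD iE2); rewrite (torus_sl2E2 s10 s20) sqrtCK.
Qed.

End Weights.

(** * Principal pairs *)

(** Two numbers satisfying [is_rank] bound each other, so the rank in the definition may be taken to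
    be the computed one. *)
Lemma principal_pairP (R : realType) N (g : {vspace 'M[R[i]]_N}) (Gad : 'M[R[i]]_N -> Prop)
    (e1 e2 : 'M[R[i]]_N) r :
  e1 \in g -> e2 \in g -> lie e1 e2 = 0 -> is_rank g r ->
  (forall t1 t2 : R[i], t1 != 0 -> t2 != 0 ->
     exists a, [/\ Gad a, a \in unitmx,
       a *m e1 *m invmx a = t1 *: e1 & a *m e2 *m invmx a = t2 *: e2]) ->
  principal_pair g Gad e1 e2 <-> \dim (g :&: cent_gl e1 :&: cent_gl e2) = r.
Proof.
move=> g1 g2 e12 rk tor; split=> [[_ _ _ [r' [rk' ->]] _]|dimr]; last first.
  by split=> //; exists r.
move: rk rk' => [[x xg xr] le] [[x' xg' xr'] le'].
by apply/eqP; rewrite eqn_leq -{2}xr' -{1}xr le' ?le.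
Qed.

Lemma sl2_triple_tr0 (R : realType) N (E H F : 'M[R[i]]_N) :
  sl2_triple E H F -> \tr H = 0.
Proof. by case=> _ [_ <-]; rewrite /lie linearB /= mxtrace_mulC subrr. Qed.

Lemma sqr_sign_mx (R : realType) (e : bool) : (-1) ^+ e * (-1) ^+ e = 1 :> R[i].
Proof. by rewrite -expr2 sqrr_sign. Qed.

Lemma form_parity (R : realType) (p : nat) (n m : 'I_p -> nat)
    (U E1 E2 B : 'M[R[i]]_(model_dim n m)) (e : bool) i :
  (forall i, 0 < n i)%N -> (forall i, 0 < m i)%N -> U \in unitmx ->
  E1 *m U = U *m shift_mx _ (@up1 p n m) -> E2 *m U = U *m shift_mx _ (@up2 p n m) ->
  B \in unitmx -> B^T = (-1) ^+ e *: B -> E1 \in gl_form B -> E2 \in gl_form B ->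
  p = 1%N -> odd (n i + m i) = e.
Proof.
move=> n0 m0 uU EU1 EU2 uB Bsym E1B E2B p1.
have [S [HS ST uS]] := form_hankel_unit uU EU1 EU2 uB Bsym E1B E2B.
move: S HS ST uS; clear E1 E2 B U uU EU1 EU2 uB Bsym E1B E2B; subst p => S HS ST uS.
by rewrite (ord1 i); apply: hankel_unit_parity HS ST uS.
Qed.

Lemma capv_rot (F : fieldType) (V : vectType F) (A B D : {vspace V}) :
  (A :&: B :&: D = (B :&: D) :&: A)%VS.
Proof. by rewrite -capvA capvC. Qed.

Section Classification.
Variables (R : realType) (p : nat) (n m : 'I_p -> nat).
Hypotheses (n_gt0 : forall i, (0 < n i)%N) (m_gt0 : forall i, (0 < m i)%N).
Local Notation C := (R[i]).
Local Notation K := (model_dim n m).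
Variables (P E1 H1 F1 E2 H2 F2 : 'M[C]_K).
Hypothesis uP : P \in unitmx.
Hypotheses (iE1 : E1 *m P = P *m model1 n m (sl2E R)) (iH1 : H1 *m P = P *m model1 n m (sl2H R)).
Hypotheses (iE2 : E2 *m P = P *m model2 n m (sl2E R)) (iH2 : H2 *m P = P *m model2 n m (sl2H R)).

Let U := P *m diag_mx (scaling n m C).

Let uU : U \in unitmx.
Proof. by rewrite unitmx_mul uP scaling_unit. Qed.

Let EU1 : E1 *m U = U *m shift_mx C (@up1 p n m).
Proof. by rewrite /U mulmxA iE1 -!mulmxA model1_sl2E. Qed.

Let EU2 : E2 *m U = U *m shift_mx C (@up2 p n m).
Proof. by rewrite /U mulmxA iE2 -!mulmxA model2_sl2E. Qed.

Lemma block_gt0 : (0 < K)%N -> (0 < p)%N.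
Proof.
rewrite lt0n; case: (posnP p) => // p0; rewrite /model_dim.
by move: n m; rewrite p0 => n' m'; rewrite big_ord0.
Qed.

Lemma sl_principal : (1 < K)%N -> sl2sl2_hom (gl_sl R K) E1 H1 F1 E2 H2 F2 ->
  principal_pair (gl_sl R K) (@SLgrp R K) E1 E2 <-> p = 1%N.
Proof.
move=> K1 [Xg tr1 tr2 comm]; have K0 : (0 < K)%N by apply: leq_trans K1.
rewrite (principal_pairP (r := K.-1)); last first.
- move=> t1 t2 t10 t20; have [a [da ua _ a1 a2]] := exists_torus_elt uP iE1 iH1 iE2 iH2
    (sl2_triple_tr0 tr1) (sl2_triple_tr0 tr2) t10 t20.
  by exists a.
- exact: is_rank_sl.
- by apply: comm; rewrite !inE eqxx ?orbT.
- by apply: Xg; rewrite !inE eqxx ?orbT.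
- by apply: Xg; rewrite !inE eqxx ?orbT.
have one : 1%:M \in (cent_gl E1 :&: cent_gl E2)%VS.
  by rewrite cent_gl_pairE !mul1mx !mulmx1 !eqxx.
(* The trace condition removes one dimension from the centralizer, just as the rank of [sl] is one
   less than [K]; the comparison is made with both put back. *)
have aux d : d.+1 = (\sum_(i < p) \sum_(j < p) minn (n i) (n j) * minn (m i) (m j))%N ->
    d = K.-1 <-> p = 1%N.
  move=> cnt; apply: iff_trans (sl_count n_gt0 m_gt0 (block_gt0 K0)).
  rewrite -cnt -/(model_dim n m).
  by split=> [->|<-] //; rewrite prednK.
apply: aux; have capE := capv_rot (gl_sl R K) (cent_gl E1) (cent_gl E2).
have dimE := dim_cent_gl_pair n_gt0 m_gt0 uU EU1 EU2.
apply: etrans (congr1 (fun W : {vspace 'M[C]_K} => (\dim W).+1) capE) _.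
apply: etrans (dim_sl_cap K0 one) _.
exact: etrans dimE (card_hankel_index n m).
Qed.

Section Form.
Variables (B : 'M[C]_K) (e : bool).
Hypotheses (uB : B \in unitmx) (Bsym : B^T = (-1) ^+ e *: B).
Hypothesis hom : sl2sl2_hom (gl_form B) E1 H1 F1 E2 H2 F2.

Let E1B : E1 \in gl_form B.
Proof. by case: hom => Xg _ _ _; apply: Xg; rewrite !inE eqxx ?orbT. Qed.
Let E2B : E2 \in gl_form B.
Proof. by case: hom => Xg _ _ _; apply: Xg; rewrite !inE eqxx ?orbT. Qed.

(** The torus element is an isometry of determinant 1, so one statement covers both the symplectic
    and the special orthogonal group. *)
Lemma form_principal (Gad : 'M[C]_K -> Prop) :
  (forall a, a^T *m B *m a = B -> \det a = 1 -> Gad a) ->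
  principal_pair (gl_form B) Gad E1 E2 <->
  (\sum_(i < p) half_par (~~ e) (n i * m i) +
   \sum_(i < p) \sum_(j < p | i < j) minn (n i) (n j) * minn (m i) (m j)
   = (\sum_(i < p) n i * m i)./2)%N.
Proof.
move=> GadP; case: hom => Xg tr1 tr2 comm.
rewrite (principal_pairP (r := K./2)); last first.
- move=> t1 t2 t10 t20; have [a [da ua aB a1 a2]] := exists_torus_elt uP iE1 iH1 iE2 iH2
    (sl2_triple_tr0 tr1) (sl2_triple_tr0 tr2) t10 t20.
  exists a; split=> //; apply: GadP da; apply: aB; apply: Xg; rewrite !inE eqxx ?orbT//.
- exact: is_rank_form (sqr_sign_mx R e) Bsym uB.
- by apply: comm; rewrite !inE eqxx ?orbT.
- exact: E2B.
- exact: E1B.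
rewrite (dim_cent_form_pair n_gt0 m_gt0 uU EU1 EU2 uB Bsym E1B E2B).
by rewrite card_hankel_sym_index.
Qed.

Lemma form_parity1 i : p = 1%N -> odd (n i + m i) = e.
Proof. exact: form_parity EU1 EU2 uB Bsym E1B E2B. Qed.

End Form.

(** The count yields a single block, and the alternating form then dictates the parity. Conversely,
    different parities make n m even, so that rounding up is harmless. *)
Lemma sp_principal (B : 'M[C]_K) : B^T = - B -> B \in unitmx -> (0 < K)%N ->
  sl2sl2_hom (gl_form B) E1 H1 F1 E2 H2 F2 ->
  principal_pair (gl_form B) (Isomgrp B) E1 E2 <->
  (exists a b : nat, Jset n m = [:: (a, b)] /\ odd a != odd b).
Proof.
move=> Bsym uB K0 hom.
have Bsym' : B^T = (-1) ^+ true *: B by rewrite expr1 scaleN1r.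
rewrite (form_principal uB Bsym' hom) //=; split=> [/(sp_count n_gt0 m_gt0) p1|].
  have {}p1 : p = 1%N by have := block_gt0 K0; lia.
  have [i [Ji _ _]] := one_block n m p1; exists (n i), (m i); split=> //.
  have := form_parity1 uB Bsym' hom i p1; rewrite oddD.
  by case: (odd (n i)) (odd (m i)) => [] [].
move=> [a [b [J ab]]]; have p1 : p = 1%N by rewrite -(size_Jset n m) J.
have [i [Ji sumE offE]] := one_block n m p1.
have ev : odd (n i * m i) = false.
  move: Ji; rewrite J => -[<- <-]; rewrite oddM.
  by move: ab; case: (odd a) (odd b) => [] [].
rewrite offE (sumE (half_par false)) (sumE id) addn0 /=.
by rewrite uphalf_half ev.
Qed.

(** The count alone decides; for a single block the common parity of n and m is read off from the
    symmetric form. *)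
Lemma so_principal (B : 'M[C]_K) : B^T = B -> B \in unitmx -> (0 < K)%N ->
  sl2sl2_hom (gl_form B) E1 H1 F1 E2 H2 F2 ->
  principal_pair (gl_form B) (SOgrp B) E1 E2 <->
  (exists a b : nat,
     (Jset n m = [:: (a, b)] /\ odd a = odd b) \/
     (odd a /\ odd b /\
        (perm_eq (Jset n m) [:: (a, b); (1%N, 1%N)] \/
         perm_eq (Jset n m) [:: (a, 1%N); (1%N, b)]))).
Proof.
move=> Bsym uB K0 hom.
have Bsym' : B^T = (-1) ^+ false *: B by rewrite expr0 scale1r.
rewrite (form_principal uB Bsym' hom) //=.
rewrite (so_count n_gt0 m_gt0 (block_gt0 K0)); split=> [[p1|[a [b ab]]]|].
- have [i [Ji _ _]] := one_block n m p1; exists (n i), (m i); left; split=> //.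
  have := form_parity1 uB Bsym' hom i p1; rewrite oddD.
  by case: (odd (n i)) (odd (m i)) => [] [].
- by exists a, b; right.
- move=> [a [b [[J _]|ab]]]; last by right; exists a, b.
  by left; rewrite -(size_Jset n m) J.
Qed.

End Classification.

Theorem theorem8p5 (R : realType) (N p : nat) (n m : 'I_p -> nat)
  (E1 H1 F1 E2 H2 F2 : 'M[R[i]]_N) :
  (forall k, 0 < n k)%N -> (forall k, 0 < m k)%N ->
  module_iso n m E1 H1 F1 E2 H2 F2 ->
  (* (i) g(V) = sl(V) *)
  [/\ ((1 < N)%N -> sl2sl2_hom (@gl_sl R N) E1 H1 F1 E2 H2 F2 ->
        principal_pair (@gl_sl R N) (@SLgrp R N) E1 E2 <-> p = 1%N),
  (* (ii) g(V) = sp(V, B), B nondegenerate alternating *)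
      (forall B : 'M[R[i]]_N, B^T = - B -> B \in unitmx -> (0 < N)%N ->
        sl2sl2_hom (gl_form B) E1 H1 F1 E2 H2 F2 ->
        principal_pair (gl_form B) (Isomgrp B) E1 E2 <->
        (exists a b : nat, Jset n m = [:: (a, b)] /\ odd a != odd b)) &
  (* (iii) g(V) = so(V, B), B nondegenerate symmetric *)
      (forall B : 'M[R[i]]_N, B^T = B -> B \in unitmx -> (2 < N)%N ->
        sl2sl2_hom (gl_form B) E1 H1 F1 E2 H2 F2 ->
        principal_pair (gl_form B) (SOgrp B) E1 E2 <->
        (exists a b : nat,
           (Jset n m = [:: (a, b)] /\ odd a = odd b) \/
           (odd a /\ odd b /\
              (perm_eq (Jset n m) [:: (a, b); (1%N, 1%N)] \/
               perm_eq (Jset n m) [:: (a, 1%N); (1%N, b)]))))].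
Proof.
move=> n0 m0 [P [/andP[rfree rfull] [iE1 iH1 _] [iE2 iH2 _]]].
have NK : N = model_dim n m by rewrite -(eqP rfull) (eqP rfree).
subst N; have uP : P \in unitmx by rewrite -row_free_unit.
split=> [K1 hom|B Bsym uB K0 hom|B Bsym uB K2 hom].
- exact: (sl_principal n0 m0 uP iE1 iH1 iE2 iH2 K1 hom).
- exact: (sp_principal n0 m0 uP iE1 iH1 iE2 iH2 Bsym uB K0 hom).
- have K0 : (0 < model_dim n m)%N by apply: leq_trans K2.
  exact: (so_principal n0 m0 uP iE1 iH1 iE2 iH2 Bsym uB K0 hom).
Qed.
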